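(* Let $a\in(0,1)$ and $b\ge 1-a$ be real numbers, and put $$\alpha=a(b+1),\quad \beta=b(1-a),\quad p=\alpha+\beta=a+b,\quad h=\alpha\beta(p+\beta),\quad k=\beta(p+1)+p.$$ Assume that either $\alpha\ge\sqrt3\,\beta$, or both $\alpha<\sqrt3\,\beta$ and $4h(\beta+p)\ge p^4$. Let $c,d\in(0,\infty)$ with $0<c/d\le(\beta+p)/k$, and let $\delta_1$ be the larger root of the equation $(c/d-1)\beta+(a-b-1)\delta-\delta^2=0$ in $\delta$, namely $$\delta_1=\frac{(a-b-1)+\sqrt{(p-1)^2+4\beta c/d}}{2}<0.$$ (1) If $\delta\in(a-1,\delta_1]$, then the function $$G(x)=\frac{F(a-1-\delta,b+\delta;p;1-x^d)-F(a-1,b;p;1-x^c)}{1-x^c}$$ is strictly decreasing from $(0,1)$ onto $(C_1(\delta),C_2(\delta))$, where $$C_1(\delta)=\frac{d}{pc}\left(\left(\frac cd-1\right)\beta+(a-b-1)\delta-\delta^2\right)\ge 0,$$ $$C_2(\delta)=\frac{1}{p\,B(a-\delta,b+1+\delta)}-\frac{1}{p\,B(a,b+1)}.$$ In particular, for all $x\in(0,1)$ and $\delta\in(a-1,\delta_1]$, $$F(a-1,b;p;1-x^c)+C_1(\delta)(1-x^c)<F(a-1-\delta,b+\delta;p;1-x^d)<F(a-1,b;p;1-x^c)+C_2(\delta)(1-x^c).$$ (2) If $\delta_1<\delta<0$, then, as functions of $x$, $F(a-1-\delta,b+\delta;p;1-x^d)$ and $F(a-1,b;p;1-x^c)$ are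 not directly comparable on $(0,1)$; that is, neither $$F(a-1,b;p;1-x^c)<F(a-1-\delta,b+\delta;p;1-x^d)$$ nor its reversed inequality holds for all $x\in(0,1)$.
   Context: $F(a,b;c;x)={}_2F_1(a,b;c;x)=\sum_{n=0}^\infty\frac{(a,n)(b,n)}{(c,n)}\frac{x^n}{n!}$ for $x\in(-1,1)$ is the Gaussian hypergeometric function, where $(a,n)=a(a+1)\cdots(a+n-1)$ for $n\ge1$ and $(a,0)=1$. $B(x,y)=\Gamma(x)\Gamma(y)/\Gamma(x+y)$ for $x,y>0$ is the Euler beta function. *)

(* Defs.v *)
From Stdlib Require Import Arith Reals.
From Coquelicot Require Import Coquelicot.
Open Scope R_scope.

(* (a, n) = a (a + 1) ... (a + n - 1) *)
Fixpoint poch (a : R) (n : nat) : R :=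
  match n with
  | O => 1
  | S m => poch a m * (a + INR m)
  end.

(* Only meaningful where the series converges, in particular for |x| < 1 when
   c is not a non-positive integer. *)
Definition hyp2F1 (a b c x : R) : R :=
  PSeries (fun n => poch a n * poch b n / poch c n / INR (fact n)) x.

(* Euler's integral, improper at both 0 and +oo; only meaningful for x > 0. *)
Definition Gamma (x : R) : R :=
  RInt_gen (fun t => Rpower t (x - 1) * exp (- t))
    (at_right 0) (Rbar_locally p_infty).

Definition Beta (x y : R) : R := Gamma x * Gamma y / Gamma (x + y).

Definition strictly_decreasing_on (f : R -> R) (l r : R) : Prop :=
  forall x y, l < x -> x < y -> y < r -> f y < f x.

(* The image of the open interval (l, r) under f is exactly (u, v). *)
Definition maps_onto (f : R -> R) (l r u v : R) : Prop :=
  forall y, u < y < v <-> exists x, l < x < r /\ f x = y.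

(* Main.v *)
Require Import Defs.
From Stdlib Require Import Arith Reals Ranalysis5 Lra Lia.
From Coquelicot Require Import Coquelicot.
Open Scope R_scope.

(** Put [u = 1 - x^c], [s = d/c] and [v = 1 - (1 - u)^s], so that [v = 1 - x^d].
    With [N u = F(a-1-delta, b+delta; p; v) - F(a-1, b; p; u)] one has [N 0 = 0]
    and [G = N u / u], so [G] decreases in [x] as soon as [N] is strictly convex
    in [u].

    Write [a0 = a], [b0 = b+1], [a1 = a-delta], [b1 = b+1+delta]; both pairs have
    sum [p+1].  The derivatives of the two series are multiples of zero-balanced
    series [g_i = F(a_i, b_i; p+1; .)], and those satisfy
    [(1-u) g_i' = (a_i b_i / (p+1)) e_i] with [e_i = F(a_i, b_i; p+2; .)].  Up to
    a positive factor, [N''] is therefore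
      [beta (a0 b0) e_0(u)
         - y (1-u)^(s-1) (s (a1 b1) e_1(v) - (s-1) (p+1) g_1(v))],
    where [y = s (1-a1) (b1-1)], and [y <= beta] because the quadratic is
    nonnegative for [delta <= delta1].  If the last bracket is nonpositive the
    expression is positive.  Otherwise [g_1 > e_1] bounds the bracket by
    [(s (a1 b1) - (s-1) (p+1)) e_1(v)], and two facts finish the argument:
    - [(1-u)^(s-1) e_1(v) < e_0(u)] ([warp_zbal1_lt]), because the quotient of the
      two sides is monotone; its derivative is governed by a Wronskian whose
      positivity follows from the hypergeometric equation ([wronskian_pos]);
    - [y (s (a1 b1) - (s-1) (p+1)) <= beta alpha] ([quadratic_bound]), which says
      that [N''] is nonnegative at [u = 0].  As a statement about a quadratic in
      [y] on [(0, beta]] it is what the condition on [alpha], [beta] guarantees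
      when [c/d <= (beta+p)/k].

    The limit of [G] at [x = 1] is [N' 0].  The limit at [x = 0] is
    a difference of two values at [1] of series [F(A, B; A+B+1; .)].  Their partial
    sums have the closed form [(A+1, n) (B+1, n) / ((A+B+1, n) n!)], and the limit
    of this quotient comes from [Gamma (x+th) <= x^th Gamma x] for [0 < th < 1].

    For [delta1 < delta < 0] the first limit is negative, while the second is
    positive since the closed form increases with the product [(A+1) (B+1)]
    ([Gauss_value_lt]); so the difference takes both signs. *)

(** * Hypergeometric series and their differential relations *)

Definition hcoef (a b c : R) (n : nat) : R :=
  poch a n * poch b n / poch c n / INR (fact n).

Definition regular (z : R) : Prop := forall n : nat, z + INR n <> 0.

Lemma regular_pos z : 0 < z -> regular z.
Proof. intros Hz n; pose proof (pos_INR n); lra. Qed.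

Lemma regular_gt_m1 z : -1 < z -> z <> 0 -> regular z.
Proof.
intros Hz Hz0 [|n]; [simpl; lra|].
rewrite S_INR; pose proof (pos_INR n); lra.
Qed.

Lemma regular_S z : regular z -> regular (z + 1).
Proof. intros H n; specialize (H (S n)); rewrite S_INR in H; lra. Qed.

Lemma poch_neq_0 z n : regular z -> poch z n <> 0.
Proof.
intros H; induction n as [|n IH]; simpl; [lra|].
apply Rmult_integral_contrapositive; split; auto.
Qed.

Lemma poch_pos z n : 0 < z -> 0 < poch z n.
Proof.
intros H; induction n as [|n IH]; simpl; [lra|].
apply Rmult_lt_0_compat; auto; pose proof (pos_INR n); lra.
Qed.

Lemma poch_S_l z n : poch z (S n) = z * poch (z + 1) n.
Proof.
induction n as [|n IH]; [simpl; ring|].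
change (poch z (S (S n))) with (poch z (S n) * (z + INR (S n))).
rewrite IH, S_INR; simpl; ring.
Qed.

Lemma hcoef_0 a b c : hcoef a b c 0 = 1.
Proof. unfold hcoef; simpl; field. Qed.

Lemma hcoef_S a b c n : regular c ->
  hcoef a b c (S n) =
  hcoef a b c n * ((a + INR n) * (b + INR n) / ((c + INR n) * (INR n + 1))).
Proof.
intros Hc; unfold hcoef.
change (fact (S n)) with (S n * fact n)%nat.
rewrite mult_INR, S_INR; simpl poch.
pose proof (poch_neq_0 c n Hc); pose proof (Hc n).
pose proof (INR_fact_neq_0 n); pose proof (pos_INR n).
field; repeat split; auto; lra.
Qed.

Lemma hcoef_neq_0 a b c n :
  regular a -> regular b -> regular c -> hcoef a b c n <> 0.
Proof.
intros Ha Hb Hc; unfold hcoef, Rdiv.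
repeat apply Rmult_integral_contrapositive_currified;
  try apply Rinv_neq_0_compat; try apply poch_neq_0; auto using INR_fact_neq_0.
Qed.

Lemma hcoef_pos a b c n : 0 < a -> 0 < b -> 0 < c -> 0 < hcoef a b c n.
Proof.
intros Ha Hb Hc; unfold hcoef.
repeat apply Rdiv_lt_0_compat; try apply Rmult_lt_0_compat;
  auto using poch_pos, INR_fact_lt_0.
Qed.

Lemma is_lim_seq_shift_ratio z w :
  regular w -> is_lim_seq (fun n => (z + INR n) / (w + INR n)) 1.
Proof.
intros Hw.
apply is_lim_seq_ext with (fun n => 1 + (z - w) * / (w + INR n)).
{ intros n; field; apply Hw. }
replace (Finite 1) with (Rbar_plus 1 (Rbar_mult (z - w) 0))
  by (simpl; f_equal; ring).
apply is_lim_seq_plus'; [apply is_lim_seq_const|].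
apply (is_lim_seq_scal_l _ (z - w) 0).
replace (Finite 0) with (Rbar_inv p_infty) by reflexivity.
apply is_lim_seq_inv; [|discriminate].
apply (is_lim_seq_plus _ _ w p_infty);
  [apply is_lim_seq_const|apply is_lim_seq_INR|reflexivity].
Qed.

Lemma hcoef_CV_radius a b c : regular a -> regular b -> regular c ->
  CV_radius (hcoef a b c) = 1.
Proof.
intros Ha Hb Hc.
replace (Finite 1) with (Finite (/ 1)) by (f_equal; field).
apply CV_radius_finite_DAlembert; [intros n; now apply hcoef_neq_0|lra|].
apply is_lim_seq_ext with
  (fun n => Rabs ((a + INR n) / (c + INR n) * ((b + INR n) / (1 + INR n)))).
{ intros n; f_equal; rewrite hcoef_S by assumption.
  pose proof (hcoef_neq_0 a b c n Ha Hb Hc); pose proof (Hc n).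
  pose proof (pos_INR n); field; repeat split; auto; lra. }
replace (Finite 1) with (Rbar_abs (Finite (1 * 1)))
  by (simpl; rewrite Rmult_1_r, Rabs_R1; reflexivity).
apply is_lim_seq_abs, is_lim_seq_mult'; apply is_lim_seq_shift_ratio; auto.
apply regular_pos; lra.
Qed.

Lemma hcoef_CV a b c u : regular a -> regular b -> regular c -> Rabs u < 1 ->
  Rbar_lt (Rabs u) (CV_radius (hcoef a b c)).
Proof. intros; rewrite hcoef_CV_radius; auto. Qed.

Lemma hcoef_ex_pseries a b c u :
  regular a -> regular b -> regular c -> Rabs u < 1 ->
  ex_pseries (hcoef a b c) u.
Proof.
intros; apply CV_radius_inside, hcoef_CV; auto.
Qed.

Lemma hcoef_derive a b c n : regular c ->
  PS_derive (hcoef a b c) n =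
  a * b / c * hcoef (a + 1) (b + 1) (c + 1) n.
Proof.
intros Hc; unfold PS_derive, hcoef.
rewrite !poch_S_l.
change (fact (S n)) with (S n * fact n)%nat; rewrite mult_INR.
pose proof (poch_neq_0 (c + 1) n (regular_S _ Hc)).
pose proof (Hc 0%nat) as Hc0; simpl in Hc0.
assert (c <> 0) by lra.
pose proof (INR_fact_neq_0 n).
assert (INR (S n) <> 0) by (apply not_0_INR; lia).
field; repeat split; auto.
Qed.

Lemma hyp2F1_derive a b c u :
  regular a -> regular b -> regular c -> Rabs u < 1 ->
  is_derive (hyp2F1 a b c) u
    (a * b / c * hyp2F1 (a + 1) (b + 1) (c + 1) u).
Proof.
intros Ha Hb Hc Hu.
pose proof (is_derive_PSeries _ _ (hcoef_CV a b c u Ha Hb Hc Hu)) as H.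
rewrite (PSeries_ext _ _ u (fun n => hcoef_derive a b c n Hc)) in H.
change (fun n : nat =>
   a * b / c * hcoef (a + 1) (b + 1) (c + 1) n)
  with (PS_scal (a * b / c) (hcoef (a + 1) (b + 1) (c + 1))) in H.
rewrite PSeries_scal in H; exact H.
Qed.

Lemma hyp2F1_0 a b c : hyp2F1 a b c 0 = 1.
Proof.
unfold hyp2F1; rewrite PSeries_0; apply hcoef_0.
Qed.

Lemma hyp2F1_ge_1 a b c u : 0 < a -> 0 < b -> 0 < c -> 0 <= u < 1 ->
  1 <= hyp2F1 a b c u.
Proof.
intros Ha Hb Hc Hu.
assert (Hex : ex_series (fun n => hcoef a b c n * u ^ n)).
{ apply ex_pseries_R, hcoef_ex_pseries; try apply regular_pos; auto.
  rewrite Rabs_pos_eq; lra. }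
change (hyp2F1 a b c u) with (Series (fun n => hcoef a b c n * u ^ n)).
rewrite Series_incr_1 by exact Hex.
rewrite hcoef_0, pow_O, Rmult_1_r.
enough (0 <= Series (fun k => hcoef a b c (S k) * u ^ S k)) by lra.
rewrite <- (Rmult_0_l (Series (fun k => hcoef a b c (S k) * u ^ S k))).
rewrite <- Series_scal_l.
apply Series_le; [|now apply (ex_series_incr_1 (fun n => hcoef a b c n * u ^ n))].
intros n; rewrite Rmult_0_l; split; [lra|].
apply Rmult_le_pos; [now apply Rlt_le, hcoef_pos|apply pow_le; lra].
Qed.

Lemma hcoef_C_succ a b c n : regular c -> 
  hcoef a b (c + 1) n = hcoef a b c n * (c / (c + INR n)).
Proof.
intros Hc; unfold hcoef.
assert (poch (c + 1) n = poch c n * (c + INR n) / c) as ->.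
{ pose proof (poch_S_l c n) as E; simpl in E; rewrite E.
  pose proof (Hc 0%nat) as H; simpl in H; field; lra. }
pose proof (poch_neq_0 c n Hc); pose proof (Hc n).
pose proof (Hc 0%nat) as H1; simpl in H1; assert (c <> 0) by lra.
pose proof (INR_fact_neq_0 n); field; repeat split; auto.
Qed.

(** Coefficientwise this is
    [(a+n) (b+n) / (a+b+n) - n = a b / (a+b+n)]; it plays the role of Euler's
    transformation [F(a+1, b+1; a+b+1; u) = F(a, b; a+b+1; u) / (1-u)].  Together
    with [hyp2F1_contiguous] it gives a first-order system that is equivalent to
    the hypergeometric equation. *)
Lemma zero_balanced_derive a b u : 0 < a -> 0 < b -> Rabs u < 1 ->
  is_derive (hyp2F1 a b (a + b)) u
    (a * b / (a + b) * hyp2F1 a b (a + b + 1) u / (1 - u)).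
Proof.
intros Ha Hb Hu.
assert (Hra := regular_pos a Ha); assert (Hrb := regular_pos b Hb).
assert (Hrc : regular (a + b)) by (apply regular_pos; lra).
pose proof (is_derive_PSeries _ _ (hcoef_CV a b (a + b) u Hra Hrb Hrc Hu)) as H.
replace (a * b / (a + b) * hyp2F1 a b (a + b + 1) u / (1 - u))
  with (PSeries (PS_derive (hcoef a b (a + b))) u); [exact H|].
assert (Hex : ex_pseries (PS_derive (hcoef a b (a + b))) u).
{ apply CV_radius_inside; rewrite CV_radius_derive; apply hcoef_CV; auto. }
assert (1 - u <> 0) by (apply Rabs_def2 in Hu; lra).
apply (Rmult_eq_reg_r (1 - u)); auto.
transitivity (a * b / (a + b) * hyp2F1 a b (a + b + 1) u); [|field; split; lra].
change (hyp2F1 a b (a + b + 1) u) with (PSeries (hcoef a b (a + b + 1)) u).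
rewrite <- PSeries_scal.
rewrite Rmult_minus_distr_l, Rmult_1_r, (Rmult_comm _ u), <- PSeries_incr_1.
rewrite <- PSeries_minus; [|exact Hex|now apply ex_pseries_incr_1].
apply PSeries_ext; intros n.
unfold PS_minus, PS_plus, PS_opp, PS_scal.
rewrite hcoef_C_succ by exact Hrc.
unfold plus, opp, scal; simpl; unfold mult; simpl.
pose proof (pos_INR n).
unfold PS_incr_1, PS_derive; destruct n as [|n].
{ rewrite hcoef_S, hcoef_0 by exact Hrc; unfold zero; simpl.
  field; repeat split; lra. }
rewrite (hcoef_S a b (a + b) (S n)) by exact Hrc.
rewrite (S_INR (S n)).
field; repeat split; lra.
Qed.

Lemma hyp2F1_contiguous a b c u :
  regular a -> regular b -> regular c -> Rabs u < 1 ->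
  u * (a * b / (c + 1) * hyp2F1 (a + 1) (b + 1) (c + 2) u) =
  c * (hyp2F1 a b c u - hyp2F1 a b (c + 1) u).
Proof.
intros Ha Hb Hc Hu.
assert (Hc1 := regular_S c Hc).
assert (Hc2 := regular_S _ Hc1).
replace (c + 2) with (c + 1 + 1) by ring.
change (hyp2F1 (a + 1) (b + 1) (c + 1 + 1) u)
  with (PSeries (hcoef (a + 1) (b + 1) (c + 1 + 1)) u).
change (hyp2F1 a b c u) with (PSeries (hcoef a b c) u).
change (hyp2F1 a b (c + 1) u) with (PSeries (hcoef a b (c + 1)) u).
rewrite <- PSeries_scal, <- PSeries_incr_1.
rewrite <- PSeries_minus; try apply hcoef_ex_pseries; auto.
rewrite <- PSeries_scal.
apply PSeries_ext; intros n.
unfold PS_minus, PS_plus, PS_opp, PS_scal, PS_incr_1.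
rewrite (hcoef_C_succ a b c) by exact Hc.
unfold plus, opp, scal; simpl; unfold mult; simpl.
pose proof (Hc n) as Hn.
destruct n as [|n].
{ unfold zero; simpl in *; field; lra. }
pose proof (hcoef_derive a b (c + 1) n Hc1) as E; unfold PS_derive in E.
rewrite <- E, hcoef_C_succ by exact Hc; field; exact Hn.
Qed.

(** * The zero-balanced series and the one above it *)

(** The intermediate point lies in the open interval, which matters below: the
    second derivative may vanish at the left endpoint. *)
Lemma mean_value (f f' : R -> R) (x y : R) : x < y ->
  (forall u, x <= u <= y -> is_derive f u (f' u)) ->
  exists z, x < z < y /\ f y - f x = f' z * (y - x).
Proof.
intros Hxy Hd.
destruct (MVT_cor2 f f' x y Hxy) as [z [E Hz]]; [|now exists z].
intros u Hu; now apply is_derive_Reals, Hd.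
Qed.

Lemma lt_of_derive_pos (f f' : R -> R) (x y : R) : x < y ->
  (forall u, x <= u <= y -> is_derive f u (f' u)) ->
  (forall u, x < u < y -> 0 < f' u) ->
  f x < f y.
Proof.
intros Hxy Hd Hp.
destruct (mean_value f f' x y Hxy Hd) as [z [Hz E]].
assert (0 < f' z * (y - x)) by (apply Rmult_lt_0_compat; [auto|lra]).
lra.
Qed.

(** A function that starts positive and is increasing at each of its zeros has no
    zero: at the first one it would come from positive values. *)
Lemma pos_of_barrier (w : R -> R) :
  0 < w 0 ->
  (forall u, 0 <= u < 1 -> continuous w u) ->
  (forall u, 0 < u < 1 -> w u = 0 -> exists l, 0 < l /\ is_derive w u l) ->
  forall u, 0 <= u < 1 -> 0 < w u.
Proof.
intros H0 Hcont Hbar x Hx.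
destruct (Rlt_or_le 0 (w x)) as [|Hneg]; [assumption|exfalso].
set (E := fun z => 0 <= z <= x /\ forall r, 0 <= r <= z -> 0 < w r).
assert (HE0 : E 0).
{ split; [lra|]; intros r Hr; replace r with 0 by lra; exact H0. }
destruct (completeness E) as [m [Hub Hlub]].
{ exists x; intros z [Hz _]; lra. }
{ exists 0; exact HE0. }
assert (Hm0 : 0 <= m) by (apply Hub, HE0).
assert (Hmx : m <= x) by (apply Hlub; intros z [Hz _]; lra).
assert (Happ : forall eps, 0 < eps -> exists z, E z /\ m - eps < z).
{ intros eps Heps.
  destruct (Classical_Prop.classic (exists z, E z /\ m - eps < z)) as [|Hn]; auto.
  exfalso; enough (m <= m - eps) by lra.
  apply Hlub; intros z Hz; apply Rnot_lt_le; intros Hlt; apply Hn; eauto. }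
assert (Hpos : forall r, 0 <= r < m -> 0 < w r).
{ intros r Hr; destruct (Happ (m - r)) as [z [[Hz Hz'] Hlt]]; [lra|].
  apply Hz'; lra. }
destruct (Rtotal_order (w m) 0) as [Hlt|[Heq|Hgt]].
- assert (Hm : 0 < m) by (destruct Hm0 as [|E0]; [auto|rewrite <- E0 in Hlt; lra]).
  destruct (Hcont m ltac:(lra) _ (open_lt 0 _ Hlt)) as [d Hd].
  pose proof (cond_pos d) as Hdp.
  set (r := Rmax 0 (m - d / 2)).
  assert (0 <= r < m) by (unfold r; split; [apply Rmax_l|apply Rmax_lub_lt; lra]).
  specialize (Hpos r ltac:(auto)).
  enough (w r < 0) by lra.
  apply Hd; unfold ball; simpl; unfold AbsRing_ball, abs, minus, plus, opp; simpl.
  pose proof (Rmax_r 0 (m - d / 2)) as Hr; fold r in Hr.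
  apply Rabs_def1; lra.
- assert (Hm : 0 < m) by (destruct Hm0 as [|E0]; [auto|rewrite <- E0 in Heq; lra]).
  destruct (Hbar m ltac:(lra) Heq) as [l [Hl Hd]].
  apply is_derive_Reals in Hd.
  destruct (Hd l Hl) as [d Hd']; pose proof (cond_pos d) as Hdp.
  set (r := Rmax 0 (m - d / 2)).
  assert (0 <= r < m) by (unfold r; split; [apply Rmax_l|apply Rmax_lub_lt; lra]).
  specialize (Hpos r ltac:(auto)).
  pose proof (Rmax_r 0 (m - d / 2)) as Hr; fold r in Hr.
  specialize (Hd' (r - m) ltac:(lra)).
  rewrite Heq in Hd'; replace (m + (r - m)) with r in Hd' by ring.
  assert (Hq : Rabs ((w r - 0) / (r - m) - l) < l) by (apply Hd'; apply Rabs_def1; lra).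
  apply Rabs_def2 in Hq.
  assert (Hw : w r = (w r - 0) / (r - m) * (r - m)) by (field; lra).
  nra.
- destruct (Hcont m ltac:(lra) _ (open_gt 0 _ Hgt)) as [d Hd].
  pose proof (cond_pos d) as Hdp.
  assert (Hm : m < x).
  { destruct Hmx as [|E0]; [auto|subst; lra]. }
  set (r := Rmin x (m + d / 2)).
  assert (m < r <= x) by (unfold r; split; [apply Rmin_glb_lt; lra|apply Rmin_l]).
  enough (E r) by (specialize (Hub r ltac:(auto)); lra).
  split; [lra|]; intros z Hz.
  destruct (Rlt_or_le z m); [apply Hpos; lra|].
  apply Hd; unfold ball; simpl; unfold AbsRing_ball, abs, minus, plus, opp; simpl.
  pose proof (Rmin_r x (m + d / 2)) as Hr; fold r in Hr.
  apply Rabs_def1; lra.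
Qed.

Definition zbal (a b u : R) : R := hyp2F1 a b (a + b) u.
(** Third parameter one above the zero-balanced value; unlike [zbal] this series
    stays bounded at [1]. *)
Definition zbal1 (a b u : R) : R := hyp2F1 a b (a + b + 1) u.
(** The derivative of [zbal1 a b]. *)
Definition dzbal1 (a b u : R) : R :=
  a * b / (a + b + 1) * hyp2F1 (a + 1) (b + 1) (a + b + 2) u.

Lemma zbal_derive a b u : 0 < a -> 0 < b -> Rabs u < 1 ->
  is_derive (zbal a b) u (a * b / (a + b) * zbal1 a b u / (1 - u)).
Proof. apply zero_balanced_derive. Qed.

Lemma zbal1_derive a b u : 0 < a -> 0 < b -> Rabs u < 1 ->
  is_derive (zbal1 a b) u (dzbal1 a b u).
Proof.
intros Ha Hb Hu; unfold dzbal1; replace (a + b + 2) with (a + b + 1 + 1) by ring.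
apply hyp2F1_derive; try apply regular_pos; auto; lra.
Qed.

Lemma dzbal1_contiguous a b u : 0 < a -> 0 < b -> Rabs u < 1 ->
  u * dzbal1 a b u = (a + b) * (zbal a b u - zbal1 a b u).
Proof.
intros Ha Hb Hu; apply hyp2F1_contiguous; try apply regular_pos; auto; lra.
Qed.

Lemma zbal_0 a b : zbal a b 0 = 1.
Proof. apply hyp2F1_0. Qed.

Lemma zbal1_0 a b : zbal1 a b 0 = 1.
Proof. apply hyp2F1_0. Qed.

Lemma dzbal1_0 a b : dzbal1 a b 0 = a * b / (a + b + 1).
Proof. unfold dzbal1; rewrite hyp2F1_0; ring. Qed.

Lemma zbal1_ge_1 a b u : 0 < a -> 0 < b -> 0 <= u < 1 -> 1 <= zbal1 a b u.
Proof. intros; apply hyp2F1_ge_1; lra. Qed.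

Lemma dzbal1_pos a b u : 0 < a -> 0 < b -> 0 <= u < 1 -> 0 < dzbal1 a b u.
Proof.
intros Ha Hb Hu; apply Rmult_lt_0_compat.
- apply Rdiv_lt_0_compat; [apply Rmult_lt_0_compat; auto|lra].
- apply Rlt_le_trans with 1; [lra|]; apply hyp2F1_ge_1; lra.
Qed.

Lemma dzbal1_derive_series a b u : 0 < a -> 0 < b -> Rabs u < 1 ->
  is_derive (dzbal1 a b) u
   (a * b / (a + b + 1) * ((a + 1) * (b + 1) / (a + b + 2) *
     hyp2F1 (a + 1 + 1) (b + 1 + 1) (a + b + 2 + 1) u)).
Proof.
intros Ha Hb Hu; unfold dzbal1.
apply (is_derive_scal (hyp2F1 (a + 1) (b + 1) (a + b + 2))).
apply hyp2F1_derive; try apply regular_pos; auto; lra.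
Qed.

Lemma locally_unit_interval u : 0 < u < 1 -> locally u (fun z => 0 < z < 1).
Proof.
intros Hu.
apply (open_and _ _ (open_gt 0) (open_lt 1)); lra.
Qed.

(** The hypergeometric equation of [zbal1], obtained by differentiating the
    contiguous relation [dzbal1 = (a+b) (zbal - zbal1) / u]. *)
Lemma dzbal1_derive a b u : 0 < a -> 0 < b -> 0 < u < 1 ->
  is_derive (dzbal1 a b) u
   ((a * b * zbal1 a b u / (1 - u) - (a + b + 1) * dzbal1 a b u) / u).
Proof.
intros Ha Hb Hu.
assert (Hau : Rabs u < 1) by (rewrite Rabs_pos_eq; lra).
apply is_derive_ext_loc with
  (fun z => (a + b) * (zbal a b z - zbal1 a b z) / z).
{ apply (filter_imp (fun z => 0 < z < 1)); [|now apply locally_unit_interval].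
  intros z Hz; rewrite <- dzbal1_contiguous; auto;
    [|rewrite Rabs_pos_eq; lra].
  change (z * dzbal1 a b z / z = dzbal1 a b z); field; lra. }
pose proof (zbal_derive a b u Ha Hb Hau) as H1.
pose proof (zbal1_derive a b u Ha Hb Hau) as H2.
auto_derive.
- repeat split; try (eexists; eassumption); lra.
- rewrite (is_derive_unique (fun x : R => zbal a b x) _ _ H1),
    (is_derive_unique (fun x : R => zbal1 a b x) _ _ H2).
  replace (zbal a b u) with (zbal1 a b u + u * dzbal1 a b u / (a + b)).
  + field; lra.
  + rewrite dzbal1_contiguous by auto; field; lra.
Qed.

(** The difference of the two sides is [u (1-u)] times the second derivative of
    [zbal1], whose coefficients are positive. *)
Lemma dzbal1_le a b u : 0 < a -> 0 < b -> 0 < u < 1 ->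
  (a + b + 1) * (1 - u) * dzbal1 a b u <= a * b * zbal1 a b u.
Proof.
intros Ha Hb Hu.
assert (Hau : Rabs u < 1) by (rewrite Rabs_pos_eq; lra).
pose proof (is_derive_unique _ _ _ (dzbal1_derive a b u Ha Hb Hu)) as E.
rewrite (is_derive_unique _ _ _ (dzbal1_derive_series a b u Ha Hb Hau)) in E.
set (D2 := a * b / _ * _) in E.
assert (HD : 0 <= D2).
{ unfold D2; repeat apply Rmult_le_pos; try lra;
    try (apply Rlt_le, Rinv_0_lt_compat; lra).
  apply Rle_trans with 1; [lra|]; apply hyp2F1_ge_1; lra. }
clearbody D2.
assert (E' : D2 * u * (1 - u) =
   a * b * zbal1 a b u - (a + b + 1) * (1 - u) * dzbal1 a b u).
{ rewrite E; field; lra. }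
assert (0 <= D2 * u * (1 - u)) by (repeat apply Rmult_le_pos; lra).
lra.
Qed.

Lemma zbal1_lt_zbal a b u : 0 < a -> 0 < b -> 0 < u < 1 ->
  zbal1 a b u < zbal a b u.
Proof.
intros Ha Hb Hu.
pose proof (dzbal1_contiguous a b u Ha Hb ltac:(rewrite Rabs_pos_eq; lra)) as E.
assert (0 < u * dzbal1 a b u)
  by (apply Rmult_lt_0_compat; [|apply dzbal1_pos]; lra).
apply Rmult_lt_reg_l with (a + b); lra.
Qed.

(** * The change of variable and a Wronskian *)

Lemma Rpower_pos x e : 0 < Rpower x e.
Proof. apply exp_pos. Qed.

Lemma Rpower_minus_1 x e : 0 < x -> Rpower x (e - 1) = Rpower x e / x.
Proof.
intros Hx; unfold Rminus; rewrite Rpower_plus, Rpower_Ropp, Rpower_1 by exact Hx.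
reflexivity.
Qed.

Lemma Rpower_lt_1 x e : 0 < x < 1 -> 0 < e -> Rpower x e < 1.
Proof.
intros Hx He; rewrite <- (Rpower_O x) by lra.
unfold Rpower; apply exp_increasing.
assert (ln x < 0) by (rewrite <- ln_1; apply ln_increasing; lra).
nra.
Qed.

Lemma Rpower_one e : Rpower 1 e = 1.
Proof. unfold Rpower; rewrite ln_1, Rmult_0_r; apply exp_0. Qed.

Lemma Rpower_derive x e : 0 < x ->
  is_derive (fun z => Rpower z e) x (e * Rpower x e / x).
Proof.
intros Hx; unfold Rpower; auto_derive; [exact Hx|field; lra].
Qed.

(** If [u = 1 - x^c] then [warp (d/c) u = 1 - x^d]. *)
Definition warp (s u : R) : R := 1 - Rpower (1 - u) s.

Lemma warp_derive s u : u < 1 ->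
  is_derive (warp s) u (s * Rpower (1 - u) s / (1 - u)).
Proof.
intros Hu; unfold warp, Rpower; auto_derive; [lra|replace (1 + - u) with (1 - u) by ring; field; lra].
Qed.

Lemma warp_0 s : warp s 0 = 0.
Proof. unfold warp; rewrite Rminus_0_r, Rpower_one; ring. Qed.

Lemma warp_range s u : 0 < s -> 0 < u < 1 -> 0 < warp s u < 1.
Proof.
intros Hs Hu; unfold warp.
pose proof (Rpower_pos (1 - u) s).
pose proof (Rpower_lt_1 (1 - u) s ltac:(lra) Hs); lra.
Qed.

Lemma warp_range0 s u : 0 < s -> 0 <= u < 1 -> 0 <= warp s u < 1.
Proof.
intros Hs [[Hu|<-] Hu1]; [|rewrite warp_0; lra].
pose proof (warp_range s u Hs); lra.
Qed.

(** Concavity of [warp s]: it vanishes at [0], so its value at [u] is at least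
    [u] times its derivative there. *)
Lemma warp_log_derivative_le s u : 1 < s -> 0 < u < 1 ->
  s * Rpower (1 - u) s / warp s u <= (1 - u) / u.
Proof.
intros Hs Hu.
assert (Hv := warp_range s u ltac:(lra) Hu).
destruct (mean_value (warp s) (fun z => s * Rpower (1 - z) s / (1 - z)) 0 u)
  as [z [Hz E]]; [lra|intros; apply warp_derive; lra|].
rewrite warp_0, !Rminus_0_r in E.
  assert (Rpower (1 - u) (s - 1) <= Rpower (1 - z) (s - 1))
    by (apply Rle_Rpower_l; lra).
  rewrite !Rpower_minus_1 in H by lra.
  apply Rle_div_l; [lra|].
  rewrite E.
  replace ((1 - u) / u * (s * Rpower (1 - z) s / (1 - z) * u))
    with ((1 - u) * s * (Rpower (1 - z) s / (1 - z))) by (field; lra).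
  replace (s * Rpower (1 - u) s)
    with ((1 - u) * s * (Rpower (1 - u) s / (1 - u))) by (field; lra).
  apply Rmult_le_compat_l; [apply Rmult_le_pos; lra|exact H].
Qed.

(** Up to a positive factor, the derivative of
    [zbal1 a0 b0 u / ((1-u)^(s-1) zbal1 a1 b1 (warp s u))]. *)
Definition wronskian (a0 b0 a1 b1 s u : R) : R :=
  (1 - u) * zbal1 a1 b1 (warp s u) * dzbal1 a0 b0 u
  + (s - 1) * zbal1 a1 b1 (warp s u) * zbal1 a0 b0 u
  - s * Rpower (1 - u) s * dzbal1 a1 b1 (warp s u) * zbal1 a0 b0 u.

Lemma wronskian_derive a0 b0 a1 b1 s u l0 l1 :
  0 < a0 -> 0 < b0 -> 0 < a1 -> 0 < b1 -> 0 < s -> 0 <= u < 1 ->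
  is_derive (dzbal1 a0 b0) u l0 ->
  is_derive (dzbal1 a1 b1) (warp s u) l1 ->
  is_derive (wronskian a0 b0 a1 b1 s) u
   (let t := 1 - u in let T := Rpower t s in let v := warp s u in
    (s - 2) * zbal1 a1 b1 v * dzbal1 a0 b0 u
    + t * zbal1 a1 b1 v * l0
    + (2 * s - 1) * (s * T / t) * dzbal1 a1 b1 v * zbal1 a0 b0 u
    - s * T * (s * T / t) * l1 * zbal1 a0 b0 u).
Proof.
intros Ha0 Hb0 Ha1 Hb1 Hs Hu Hl0 Hl1.
assert (Hv := warp_range0 s u Hs Hu).
pose proof (zbal1_derive a0 b0 u Ha0 Hb0 ltac:(rewrite Rabs_pos_eq; lra)) as H0.
pose proof (zbal1_derive a1 b1 (warp s u) Ha1 Hb1 ltac:(rewrite Rabs_pos_eq; lra)) as H1.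
pose proof (warp_derive s u ltac:(lra)) as Hp.
pose proof (Rpower_derive (1 - u) s ltac:(lra)) as HT.
cbv zeta; unfold wronskian.
auto_derive.
- repeat split; try (eexists; eassumption).
- change (1 + - u) with (1 - u); rewrite (is_derive_unique (fun x : R => zbal1 a0 b0 x) _ _ H0),
   (is_derive_unique (fun x : R => zbal1 a1 b1 x) _ _ H1),
   (is_derive_unique (fun x : R => dzbal1 a0 b0 x) _ _ Hl0),
   (is_derive_unique (fun x : R => dzbal1 a1 b1 x) _ _ Hl1),
   (is_derive_unique (fun x : R => warp s x) _ _ Hp),
   (is_derive_unique (fun x : R => Rpower x s) _ _ HT).
  field; lra.
Qed.

(** At a zero of the Wronskian the term in [dzbal1 a1 b1] can be eliminated, and
    after multiplication by [1-u] the hypergeometric equations turn the derivative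
    into
      [3 (s-1) Q + (2s-1) (s-1) P + k0 (...) - k1 (...)]
    with [P = g1 g0] and [Q = (1-u) g1 d0] positive, [k0 = (1-u)/u] and
    [k1 = s (1-u)^s / warp s u <= k0].  The factor of [k1] is nonnegative by
    [dzbal1_le], so [k1] may be replaced by [k0]; what remains of these terms is
    [k0] times [(a0 b0 + (a0+b0+1) (s-1) - s a1 b1) P], positive by hypothesis. *)
Lemma wronskian_pos a0 b0 a1 b1 s u :
  0 < a0 -> 0 < b0 -> 0 < a1 -> 0 < b1 -> a0 + b0 = a1 + b1 -> 1 < s ->
  s * (a1 * b1) < a0 * b0 + (a0 + b0 + 1) * (s - 1) ->
  0 <= u < 1 -> 0 < wronskian a0 b0 a1 b1 s u.
Proof.
intros Ha0 Hb0 Ha1 Hb1 Hab Hs Hprod; revert u.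
apply pos_of_barrier.
- unfold wronskian; rewrite warp_0, !zbal1_0, !dzbal1_0, Rminus_0_r, Rpower_one.
  rewrite <- Hab.
  replace (1 * 1 * (a0 * b0 / (a0 + b0 + 1)) + (s - 1) * 1 * 1 -
    s * 1 * (a1 * b1 / (a0 + b0 + 1)) * 1) with
    ((a0 * b0 + (a0 + b0 + 1) * (s - 1) - s * (a1 * b1)) / (a0 + b0 + 1))
    by (field; lra).
  apply Rdiv_lt_0_compat; lra.
- intros u Hu.
  assert (Hv := warp_range0 s u ltac:(lra) Hu).
  apply (ex_derive_continuous (V := R_NormedModule)).
  eexists; apply wronskian_derive; auto; try lra;
    apply dzbal1_derive_series; auto; rewrite Rabs_pos_eq; lra.
- intros u Hu HW.
  assert (Hv := warp_range s u ltac:(lra) Hu).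
  eexists; split; [|apply wronskian_derive; try apply dzbal1_derive; lra].
  cbv zeta.
  pose proof (warp_log_derivative_le s u Hs Hu) as HK.
  pose proof (dzbal1_le a1 b1 _ Ha1 Hb1 Hv) as Hle.
  pose proof (zbal1_ge_1 a0 b0 u Ha0 Hb0 ltac:(lra)) as G0.
  pose proof (zbal1_ge_1 a1 b1 (warp s u) Ha1 Hb1 ltac:(lra)) as G1.
  pose proof (dzbal1_pos a0 b0 u Ha0 Hb0 ltac:(lra)) as D0.
  replace (1 - warp s u) with (Rpower (1 - u) s) in Hle |- * by (unfold warp; ring).
  pose proof (Rpower_pos (1 - u) s) as HT.
  unfold wronskian in HW.
  rewrite <- Hab in *.
  set (T := Rpower (1 - u) s) in *; set (v := warp s u) in *.
  set (g0 := zbal1 a0 b0 u) in *; set (g1 := zbal1 a1 b1 v) in *.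
  set (d0 := dzbal1 a0 b0 u) in *; set (d1 := dzbal1 a1 b1 v) in *.
  clearbody T v g0 g1 d0 d1.
  set (C := a0 + b0 + 1) in *.
  apply Rmult_lt_reg_l with (1 - u); [lra|rewrite Rmult_0_r].
  assert (Hbr : 0 <= s * (a1 * b1 * g1 - C * T * d1) * g0)
    by (apply Rmult_le_pos; [apply Rmult_le_pos|]; lra).
  apply Rmult_le_compat_r with (2 := HK) in Hbr.
  assert (HP : 0 < g1 * g0) by (apply Rmult_lt_0_compat; lra).
  assert (HQ : 0 < (1 - u) * g1 * d0)
    by (repeat apply Rmult_lt_0_compat; lra).
  assert (Hk : 0 < (1 - u) / u) by (apply Rdiv_lt_0_compat; lra).
  assert (HkP : 0 < (1 - u) / u *
    ((a0 * b0 + C * (s - 1) - s * (a1 * b1)) * (g1 * g0)))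
    by (apply Rmult_lt_0_compat; [|apply Rmult_lt_0_compat]; lra).
  assert (HSQ : 0 < (s - 1) * ((1 - u) * g1 * d0))
    by (apply Rmult_lt_0_compat; lra).
  assert (HSP : 0 < (2 * s - 1) * ((s - 1) * (g1 * g0)))
    by (repeat apply Rmult_lt_0_compat; lra).
  (* the vanishing of the Wronskian, solved for the [d1] term *)
  assert (HW' : s * T * d1 * g0 = (1 - u) * g1 * d0 + (s - 1) * g1 * g0) by lra.
  assert (E : (1 - u) * ((s - 2) * g1 * d0 +
      (1 - u) * g1 * ((a0 * b0 * g0 / (1 - u) - C * d0) / u) +
      (2 * s - 1) * (s * T / (1 - u)) * d1 * g0 -
      s * T * (s * T / (1 - u)) * ((a1 * b1 * g1 / T - C * d1) / v) * g0)
    = (s - 2) * ((1 - u) * g1 * d0) + (2 * s - 1) * (s * T * d1 * g0)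
      + (1 - u) / u * (a0 * b0 * (g1 * g0) - C * ((1 - u) * g1 * d0))
      - s * T / v * (s * (a1 * b1 * g1 - C * T * d1) * g0))
    by (field; lra).
  rewrite E.
  replace (s * (a1 * b1 * g1 - C * T * d1) * g0)
    with (s * (a1 * b1) * (g1 * g0) - C * (s * T * d1 * g0)) in * by ring.
  (* only the terms [HkP], [HSQ], [HSP] are left once [Hbr] is used *)
  rewrite HW' in *; nra.
Qed.

(** * The difference quotient is increasing *)

Lemma warp_zbal1_lt a0 b0 a1 b1 s u :
  0 < a0 -> 0 < b0 -> 0 < a1 -> 0 < b1 -> a0 + b0 = a1 + b1 -> 1 < s ->
  s * (a1 * b1) < a0 * b0 + (a0 + b0 + 1) * (s - 1) ->
  0 < u < 1 ->
  Rpower (1 - u) (s - 1) * zbal1 a1 b1 (warp s u) < zbal1 a0 b0 u.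
Proof.
intros Ha0 Hb0 Ha1 Hb1 Hab Hs Hprod Hu.
set (A := fun z => Rpower (1 - z) (s - 1) * zbal1 a1 b1 (warp s z)).
assert (HA : forall z, 0 <= z < 1 -> 0 < A z).
{ intros z Hz; apply Rmult_lt_0_compat; [apply Rpower_pos|].
  apply Rlt_le_trans with 1; [lra|].
  apply zbal1_ge_1; auto; apply warp_range0; lra. }
change (A u < zbal1 a0 b0 u).
rewrite <- (Rmult_1_l (A u)).
apply Rlt_div_r; [apply Rlt_gt, HA; lra|].
replace 1 with (zbal1 a0 b0 0 / A 0)
  by (unfold A; rewrite warp_0, !zbal1_0, Rminus_0_r, Rpower_one; field).
apply (lt_of_derive_pos (fun z => zbal1 a0 b0 z / A z)
  (fun z => wronskian a0 b0 a1 b1 s z * Rpower (1 - z) (s - 1) / (1 - z) / A z ^ 2));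
  [lra| |].
- intros z Hz.
  specialize (HA z ltac:(lra)).
  assert (Hv := warp_range0 s z ltac:(lra) ltac:(lra)).
  pose proof (zbal1_derive a0 b0 z Ha0 Hb0 ltac:(rewrite Rabs_pos_eq; lra)) as H0.
  pose proof (zbal1_derive a1 b1 _ Ha1 Hb1
    ltac:(rewrite Rabs_pos_eq; [apply Hv|lra])) as H1.
  pose proof (warp_derive s z ltac:(lra)) as Hp.
  pose proof (Rpower_derive (1 - z) (s - 1) ltac:(lra)) as HT.
  unfold A in *; auto_derive.
  + repeat split; try (eexists; eassumption).
    apply Rgt_not_eq; exact HA.
  + change (1 + - z) with (1 - z).
    rewrite (is_derive_unique (fun x : R => zbal1 a0 b0 x) _ _ H0),
      (is_derive_unique (fun x : R => zbal1 a1 b1 x) _ _ H1),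
      (is_derive_unique (fun x : R => warp s x) _ _ Hp),
      (is_derive_unique (fun x : R => Rpower x (s - 1)) _ _ HT).
    unfold wronskian.
    pose proof (Rpower_pos (1 - z) (s - 1)).
    assert (zbal1 a1 b1 (warp s z) <> 0) by (intros E; rewrite E in HA; lra).
    field; repeat split; lra.
- intros z Hz; specialize (HA z ltac:(lra)).
  repeat apply Rdiv_lt_0_compat; try apply Rmult_lt_0_compat; try lra.
  + apply wronskian_pos; auto; lra.
  + apply Rpower_pos.
Qed.

(** The difference of the two sides is a positive multiple of the second
    derivative of [excess].  When the bracket is positive, [zbal > zbal1] lets
    [zbal1 a1 b1] be factored out, and [warp_zbal1_lt] compares it with
    [zbal1 a0 b0]; the hypothesis on [y] is the weak inequality at [u = 0]. *)
Lemma concavity_defect_pos a0 b0 a1 b1 s beta y u :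
  0 < a0 -> 0 < b0 -> 0 < a1 -> 0 < b1 -> a0 + b0 = a1 + b1 -> 1 < s ->
  s * (a1 * b1) < a0 * b0 + (a0 + b0 + 1) * (s - 1) ->
  0 < beta -> 0 < y ->
  y * (s * (a1 * b1) - (s - 1) * (a0 + b0)) <= beta * (a0 * b0) ->
  0 < u < 1 ->
  y * Rpower (1 - u) (s - 1) *
    (s * (a1 * b1) * zbal1 a1 b1 (warp s u)
     - (s - 1) * (a0 + b0) * zbal a1 b1 (warp s u))
  < beta * (a0 * b0) * zbal1 a0 b0 u.
Proof.
intros Ha0 Hb0 Ha1 Hb1 Hab Hs Hprod Hbeta Hy Hmain Hu.
pose proof (warp_zbal1_lt a0 b0 a1 b1 s u Ha0 Hb0 Ha1 Hb1 Hab Hs Hprod Hu) as HA.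
assert (Hv := warp_range s u ltac:(lra) Hu).
pose proof (zbal1_lt_zbal a1 b1 _ Ha1 Hb1 Hv) as Hg.
pose proof (zbal1_ge_1 a1 b1 _ Ha1 Hb1 (conj (Rlt_le _ _ (proj1 Hv)) (proj2 Hv))) as G1.
pose proof (zbal1_ge_1 a0 b0 u Ha0 Hb0 ltac:(lra)) as G0.
pose proof (Rpower_pos (1 - u) (s - 1)) as HT.
set (T := Rpower (1 - u) (s - 1)) in *.
set (g1 := zbal1 a1 b1 (warp s u)) in *; set (z1 := zbal a1 b1 (warp s u)) in *.
set (g0 := zbal1 a0 b0 u) in *.
assert (Hba : 0 < beta * (a0 * b0) * g0)
  by (repeat apply Rmult_lt_0_compat; lra).
assert (HyT : 0 < y * T) by (apply Rmult_lt_0_compat; lra).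
destruct (Rle_or_lt (s * (a1 * b1) * g1 - (s - 1) * (a0 + b0) * z1) 0) as [Hn|Hpos].
- apply Rle_lt_trans with (2 := Hba).
  rewrite <- (Rmult_0_r (y * T)); apply Rmult_le_compat_l; lra.
- assert (Hlt : s * (a1 * b1) * g1 - (s - 1) * (a0 + b0) * z1 <
    (s * (a1 * b1) - (s - 1) * (a0 + b0)) * g1).
  { assert (0 < (s - 1) * (a0 + b0) * (z1 - g1))
      by (repeat apply Rmult_lt_0_compat; lra).
    lra. }
  assert (He : 0 < s * (a1 * b1) - (s - 1) * (a0 + b0)).
  { apply Rmult_lt_reg_r with g1; lra. }
  apply Rlt_le_trans with
    (y * T * ((s * (a1 * b1) - (s - 1) * (a0 + b0)) * g1));
    [apply Rmult_lt_compat_l; lra|].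
  replace (y * T * ((s * (a1 * b1) - (s - 1) * (a0 + b0)) * g1))
    with (y * (s * (a1 * b1) - (s - 1) * (a0 + b0)) * (T * g1)) by ring.
  apply Rle_trans with
    (y * (s * (a1 * b1) - (s - 1) * (a0 + b0)) * g0).
  + apply Rmult_le_compat_l; [apply Rlt_le, Rmult_lt_0_compat|]; lra.
  + apply Rmult_le_compat_r; lra.
Qed.

(** The parameters are shifted down by one so that the derivatives involve
    the zero-balanced series of the given parameters. *)
Definition excess (a0 b0 a1 b1 s u : R) : R :=
  hyp2F1 (a1 - 1) (b1 - 1) (a1 + b1 - 1) (warp s u)
  - hyp2F1 (a0 - 1) (b0 - 1) (a0 + b0 - 1) u.

Definition dexcess (a0 b0 a1 b1 s u : R) : R :=
  ((1 - a0) * (b0 - 1) * zbal a0 b0 u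
   - s * ((1 - a1) * (b1 - 1)) * (Rpower (1 - u) (s - 1) * zbal a1 b1 (warp s u)))
  / (a0 + b0 - 1).

Lemma excess_0 a0 b0 a1 b1 s : excess a0 b0 a1 b1 s 0 = 0.
Proof. unfold excess; rewrite warp_0, !hyp2F1_0; ring. Qed.

Lemma hyp2F1_pred_derive a b u : 0 < a < 1 -> 1 < b -> Rabs u < 1 ->
  is_derive (hyp2F1 (a - 1) (b - 1) (a + b - 1)) u
    (- ((1 - a) * (b - 1) / (a + b - 1) * zbal a b u)).
Proof.
intros Ha Hb Hu.
replace (- ((1 - a) * (b - 1) / (a + b - 1) * zbal a b u)) with
  ((a - 1) * (b - 1) / (a + b - 1) *
    hyp2F1 (a - 1 + 1) (b - 1 + 1) (a + b - 1 + 1) u).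
- apply hyp2F1_derive; auto; [apply regular_gt_m1|apply regular_pos..]; lra.
- unfold zbal; replace (a - 1 + 1) with a by ring.
  replace (b - 1 + 1) with b by ring.
  replace (a + b - 1 + 1) with (a + b) by ring; field; lra.
Qed.

Lemma excess_derive a0 b0 a1 b1 s u :
  0 < a0 < 1 -> 1 < b0 -> 0 < a1 < 1 -> 1 < b1 -> a0 + b0 = a1 + b1 ->
  0 < s -> 0 <= u < 1 ->
  is_derive (excess a0 b0 a1 b1 s) u (dexcess a0 b0 a1 b1 s u).
Proof.
intros Ha0 Hb0 Ha1 Hb1 Hab Hs Hu.
assert (Hv := warp_range0 s u Hs Hu).
pose proof (hyp2F1_pred_derive a0 b0 u Ha0 Hb0 ltac:(rewrite Rabs_pos_eq; lra)) as H0.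
pose proof (hyp2F1_pred_derive a1 b1 _ Ha1 Hb1
    ltac:(rewrite Rabs_pos_eq; [apply Hv|lra])) as H1.
pose proof (warp_derive s u ltac:(lra)) as Hp.
unfold excess, dexcess; auto_derive.
- repeat split; try (eexists; eassumption).
- rewrite
    (is_derive_unique (fun x : R => hyp2F1 (a0 - 1) (b0 - 1) (a0 + b0 - 1) x) _ _ H0),
    (is_derive_unique (fun x : R => hyp2F1 (a1 - 1) (b1 - 1) (a1 + b1 - 1) x) _ _ H1),
    (is_derive_unique (fun x : R => warp s x) _ _ Hp).
  rewrite Rpower_minus_1, <- Hab by lra.
  field; lra.
Qed.

Lemma dexcess_derive a0 b0 a1 b1 s u :
  0 < a0 < 1 -> 1 < b0 -> 0 < a1 < 1 -> 1 < b1 -> a0 + b0 = a1 + b1 ->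
  0 < s -> 0 <= u < 1 ->
  is_derive (dexcess a0 b0 a1 b1 s) u
    (((1 - a0) * (b0 - 1) * (a0 * b0) * zbal1 a0 b0 u
      - s * ((1 - a1) * (b1 - 1)) * Rpower (1 - u) (s - 1) *
      (s * (a1 * b1) * zbal1 a1 b1 (warp s u)
       - (s - 1) * (a0 + b0) * zbal a1 b1 (warp s u)))
     / ((a0 + b0 - 1) * (a0 + b0) * (1 - u))).
Proof.
intros Ha0 Hb0 Ha1 Hb1 Hab Hs Hu.
assert (Hv := warp_range0 s u Hs Hu).
pose proof (zbal_derive a0 b0 u ltac:(lra) ltac:(lra)
  ltac:(rewrite Rabs_pos_eq; lra)) as H0.
pose proof (zbal_derive a1 b1 (warp s u) ltac:(lra) ltac:(lra)
    ltac:(rewrite Rabs_pos_eq; [apply Hv|lra])) as H1.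
pose proof (warp_derive s u ltac:(lra)) as Hp.
pose proof (Rpower_derive (1 - u) (s - 1) ltac:(lra)) as HT.
unfold dexcess; auto_derive.
- repeat split; try (eexists; eassumption).
- change (1 + - u) with (1 - u).
  rewrite (is_derive_unique (fun x : R => zbal a0 b0 x) _ _ H0),
    (is_derive_unique (fun x : R => zbal a1 b1 x) _ _ H1),
    (is_derive_unique (fun x : R => warp s x) _ _ Hp),
    (is_derive_unique (fun x : R => Rpower x (s - 1)) _ _ HT).
  replace (1 - warp s u) with (Rpower (1 - u) s) by (unfold warp; ring).
  pose proof (Rpower_pos (1 - u) s).
  rewrite <- Hab.
  field; lra.
Qed.

(** Write [N] for [excess a0 b0 a1 b1 s].  The derivative of [N u / u] has
    the sign of [u N' u - N u], that is of [N' u - N' z] for some [z] below [u],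
    and [N'] is strictly increasing. *)
Lemma slope_incr a0 b0 a1 b1 s x y :
  0 < a0 < 1 -> 1 < b0 -> 0 < a1 < 1 -> 1 < b1 -> a0 + b0 = a1 + b1 -> 1 < s ->
  s * (a1 * b1) < a0 * b0 + (a0 + b0 + 1) * (s - 1) ->
  s * ((1 - a1) * (b1 - 1)) * (s * (a1 * b1) - (s - 1) * (a0 + b0)) <=
    (1 - a0) * (b0 - 1) * (a0 * b0) ->
  0 < x -> x < y -> y < 1 ->
  excess a0 b0 a1 b1 s x / x < excess a0 b0 a1 b1 s y / y.
Proof.
intros Ha0 Hb0 Ha1 Hb1 Hab Hs Hprod Hmain Hx Hxy Hy.
assert (Hn := fun u Hu =>
  excess_derive a0 b0 a1 b1 s u Ha0 Hb0 Ha1 Hb1 Hab ltac:(lra) Hu).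
assert (Hd := fun u Hu =>
  dexcess_derive a0 b0 a1 b1 s u Ha0 Hb0 Ha1 Hb1 Hab ltac:(lra) Hu).
set (n := excess a0 b0 a1 b1 s) in *; set (n' := dexcess a0 b0 a1 b1 s) in *.
apply (lt_of_derive_pos (fun u => n u / u) (fun u => (n' u * u - n u) / u ^ 2));
  [auto| |].
- intros u Hu; specialize (Hn u ltac:(lra)).
  auto_derive; [repeat split; [eexists; eassumption|lra]|].
  rewrite (is_derive_unique (fun x : R => n x) _ _ Hn); field; lra.
- intros u Hu; apply Rdiv_lt_0_compat; [|apply pow_lt; lra].
  destruct (mean_value n n' 0 u) as [z [Hz E]]; [lra|intros; apply Hn; lra|].
  unfold n in E at 2; rewrite excess_0, !Rminus_0_r in E; rewrite E.
  enough (n' z < n' u).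
  { assert (0 < (n' u - n' z) * u) by (apply Rmult_lt_0_compat; lra); lra. }
  eapply lt_of_derive_pos; [lra|intros w Hw; apply Hd; lra|].
  intros w Hw; cbv beta; apply Rdiv_lt_0_compat.
  + apply Rlt_0_minus, concavity_defect_pos; try assumption; try lra.
    * apply Rmult_lt_0_compat; lra.
    * repeat apply Rmult_lt_0_compat; lra.
  + repeat apply Rmult_lt_0_compat; lra.
Qed.

Lemma slope_at_right_0 a0 b0 a1 b1 s :
  0 < a0 < 1 -> 1 < b0 -> 0 < a1 < 1 -> 1 < b1 -> a0 + b0 = a1 + b1 -> 0 < s ->
  filterlim (fun u => excess a0 b0 a1 b1 s u / u) (at_right 0)
    (locally (((1 - a0) * (b0 - 1) - s * ((1 - a1) * (b1 - 1))) / (a0 + b0 - 1))).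
Proof.
intros Ha0 Hb0 Ha1 Hb1 Hab Hs.
pose proof (excess_derive a0 b0 a1 b1 s 0 Ha0 Hb0 Ha1 Hb1 Hab Hs ltac:(lra)) as H.
unfold dexcess in H; rewrite warp_0, !zbal_0, Rminus_0_r, Rpower_one, !Rmult_1_r in H.
apply is_derive_Reals in H.
apply filterlim_locally; intros eps.
destruct (H eps (cond_pos eps)) as [d Hd].
exists d; intros u Hu Hu0.
specialize (Hd u ltac:(lra)).
rewrite Rplus_0_l, excess_0, Rminus_0_r in Hd; apply Hd.
unfold ball in Hu; simpl in Hu; unfold AbsRing_ball, abs, minus, plus, opp in Hu.
simpl in Hu; rewrite Ropp_0, Rplus_0_r in Hu; exact Hu.
Qed.

Lemma at_right_0_lt x : 0 < x -> at_right 0 (fun u => 0 < u < x).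
Proof.
intros Hx; exists (mkposreal x Hx); intros u Hu Hu0.
unfold ball in Hu; simpl in Hu; unfold AbsRing_ball, abs, minus, plus, opp in Hu.
simpl in Hu; apply Rabs_def2 in Hu; lra.
Qed.

Lemma at_left_1_gt x : x < 1 -> at_left 1 (fun u => x < u < 1).
Proof.
intros Hx; exists (mkposreal (1 - x) (proj2 (Rlt_0_minus _ _) Hx)); intros u Hu Hu0.
unfold ball in Hu; simpl in Hu; unfold AbsRing_ball, abs, minus, plus, opp in Hu.
simpl in Hu; apply Rabs_def2 in Hu; lra.
Qed.

Lemma image_of_strictly_increasing (f : R -> R) (l r : R) :
  (forall x y, 0 < x -> x < y -> y < 1 -> f x < f y) ->
  (forall x, 0 < x < 1 -> continuous f x) ->
  filterlim f (at_right 0) (locally l) ->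
  filterlim f (at_left 1) (locally r) ->
  forall y, l < y < r <-> exists x, 0 < x < 1 /\ f x = y.
Proof.
intros Hincr Hcont Hl Hr.
assert (near0 : forall P x, 0 < x -> at_right 0 P -> exists z, 0 < z < x /\ P z)
  by (intros P x Hx HP; apply (filter_ex _ (filter_and _ _ (at_right_0_lt x Hx) HP))).
assert (near1 : forall P x, x < 1 -> at_left 1 P -> exists z, x < z < 1 /\ P z)
  by (intros P x Hx HP; apply (filter_ex _ (filter_and _ _ (at_left_1_gt x Hx) HP))).
assert (lower : forall x, 0 < x < 1 -> l < f x).
{ intros x Hx; apply Rle_lt_trans with (f (x / 2)); [|apply Hincr; lra].
  apply Rnot_lt_le; intros Hlt.
  destruct (near0 _ (x / 2) ltac:(lra) (Hl _ (open_gt _ _ Hlt))) as [z [Hz Hz']].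
  pose proof (Hincr z (x / 2)); lra. }
assert (upper : forall x, 0 < x < 1 -> f x < r).
{ intros x Hx; apply Rlt_le_trans with (f ((x + 1) / 2)); [apply Hincr; lra|].
  apply Rnot_lt_le; intros Hlt.
  destruct (near1 _ ((x + 1) / 2) ltac:(lra) (Hr _ (open_lt _ _ Hlt))) as [z [Hz Hz']].
  pose proof (Hincr ((x + 1) / 2) z); lra. }
intros y; split; [|intros [x [Hx <-]]; auto].
intros [Hly Hyr].
destruct (near0 _ 1 ltac:(lra) (Hl _ (open_lt _ _ Hly))) as [x0 [Hx0 Hx0']].
destruct (near1 _ x0 ltac:(lra) (Hr _ (open_gt _ _ Hyr))) as [x1 [Hx1 Hx1']].
destruct (IVT_interv (fun z => f z - y) x0 x1) as [z [Hz E]]; try lra.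
- intros z Hz; apply continuity_pt_filterlim.
  apply (continuous_minus f (fun _ => y)); [apply Hcont; lra|].
  apply continuous_const.
- exists z; split; lra.
Qed.

(** * Euler's integral for the Gamma function *)

Lemma ln_le_minus_1 z : 0 < z -> ln z <= z - 1.
Proof.
intros Hz; pose proof (exp_ineq1_le (ln z)) as H; rewrite exp_ln in H; lra.
Qed.

Lemma continuous_ex_RInt_pos (f : R -> R) a b :
  (forall t, 0 < t -> continuous f t) -> 0 < a -> a <= b -> ex_RInt f a b.
Proof.
intros Hf Ha Hab; apply (ex_RInt_continuous (V := R_CompleteNormedModule)).
intros z; rewrite Rmin_left, Rmax_right by lra; intros Hz; apply Hf; lra.
Qed.

(** For a nonnegative integrand the improper integral is a supremum; the
    least-upper-bound form later gives lower and upper bounds for it directly. *)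
Lemma is_RInt_gen_sup (f : R -> R) (M : R) :
  (forall t, 0 < t -> continuous f t) ->
  (forall t, 0 < t -> 0 <= f t) ->
  (forall a b, 0 < a -> a < b -> RInt f a b <= M) ->
  exists l, is_RInt_gen f (at_right 0) (Rbar_locally p_infty) l /\
    is_lub (fun v => exists a b, 0 < a /\ a < b /\ v = RInt f a b) l.
Proof.
intros Hcont Hpos HM.
destruct (completeness (fun v => exists a b, 0 < a /\ a < b /\ v = RInt f a b))
  as [l Hl].
{ exists M; intros v [a [b [Ha [Hab ->]]]]; auto. }
{ exists (RInt f 1 2), 1, 2; repeat split; lra. }
exists l; split; [|exact Hl].
intros P [eps Heps].
destruct (Classical_Prop.classic (exists a b, 0 < a /\ a < b /\ l - eps < RInt f a b))
  as [[a0 [b0 [Ha0 [Hab0 Hlt]]]]|Hn].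
2:{ exfalso; pose proof (cond_pos eps).
    enough (l <= l - eps) by lra.
    apply Hl; intros v [a [b [Ha [Hab ->]]]].
    apply Rnot_lt_le; intros Hlt; apply Hn; exists a, b; auto. }
unfold filtermapi.
apply Filter_prod with (fun a => 0 < a < a0) (fun b => b0 < b).
- exists (mkposreal a0 Ha0); intros y Hy Hy0; split; [exact Hy0|].
  unfold ball in Hy; simpl in Hy; unfold AbsRing_ball, abs, minus, plus, opp in Hy.
  simpl in Hy; apply Rabs_def2 in Hy; lra.
- exists b0; auto.
- intros a b Ha Hb; simpl; exists (RInt f a b); split.
  + apply (RInt_correct (V := R_CompleteNormedModule)).
    apply continuous_ex_RInt_pos; auto; lra.
  + apply Heps.
    assert (RInt f a b <= l) by (apply Hl; exists a, b; repeat split; lra).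
    assert (RInt f a0 b0 <= RInt f a b).
    { rewrite <- (RInt_Chasles f a a0 b), <- (RInt_Chasles f a0 b0 b);
        try (apply continuous_ex_RInt_pos; auto; lra).
      assert (0 <= RInt f a a0)
        by (apply RInt_ge_0; [lra|apply continuous_ex_RInt_pos; auto; lra|];
            intros; apply Hpos; lra).
      assert (0 <= RInt f b0 b)
        by (apply RInt_ge_0; [lra|apply continuous_ex_RInt_pos; auto; lra|];
            intros; apply Hpos; lra).
      unfold plus; simpl; lra. }
    unfold ball; simpl; unfold AbsRing_ball, abs, minus, plus, opp; simpl.
    pose proof (cond_pos eps); apply Rabs_def1; lra.
Qed.

Definition gamma_integrand (x t : R) : R := Rpower t (x - 1) * exp (- t).

Lemma gamma_integrand_pos x t : 0 < gamma_integrand x t.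
Proof. apply Rmult_lt_0_compat; apply exp_pos. Qed.

Lemma gamma_integrand_continuous x t : 0 < t -> continuous (gamma_integrand x) t.
Proof.
intros Ht; apply (ex_derive_continuous (V := R_NormedModule)).
unfold gamma_integrand, Rpower; auto_derive; exact Ht.
Qed.

(** The constant comes from [ln z <= z - 1] at [z = (1+t)/m]. *)
Lemma exp_neg_le_Rpower m : 0 < m ->
  exists K, 0 < K /\ forall t, 0 < t -> exp (- t) <= K * Rpower (1 + t) (- m).
Proof.
intros Hm; exists (exp (1 + m * (ln m - 1))); split; [apply exp_pos|].
intros t Ht; unfold Rpower; rewrite <- exp_plus.
enough (- t <= 1 + m * (ln m - 1) + - m * ln (1 + t)) as [H|H].
{ left; now apply exp_increasing. }
{ right; now f_equal. }
pose proof (ln_le_minus_1 ((1 + t) / m) ltac:(apply Rdiv_lt_0_compat; lra)) as H.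
rewrite ln_div in H by lra.
apply Rmult_le_compat_l with (r := m) in H; [|lra].
replace (m * ((1 + t) / m - 1)) with (1 + t - m) in H by (field; lra).
lra.
Qed.

(** The bound [e^(-t) <= K (1+t)^(-x-1)] controls both ends at once: the function
    [t^(x-1) (1+t)^(-x-1)] is the derivative of the bounded function
    [(t/(1+t))^x / x]. *)
Lemma gamma_integrand_RInt_bounded x : 0 < x ->
  exists M, forall a b, 0 < a -> a < b -> RInt (gamma_integrand x) a b <= M.
Proof.
intros Hx.
destruct (exp_neg_le_Rpower (x + 1) ltac:(lra)) as [K [HK HKt]].
exists (K / x); intros a b Ha Hab.
set (F := fun t => K / x * (Rpower t x * Rpower (1 + t) (- x))).
set (F' := fun t => K * (Rpower t (x - 1) * Rpower (1 + t) (- (x + 1)))).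
assert (HF : forall t, 0 < t -> is_derive F t (F' t)).
{ intros t Ht; unfold F, F'.
  pose proof (Rpower_derive t x Ht) as H1.
  pose proof (Rpower_derive (1 + t) (- x) ltac:(lra)) as H2.
  auto_derive; [repeat split; eexists; eassumption|].
  rewrite (is_derive_unique (fun z : R => Rpower z x) _ _ H1),
   (is_derive_unique (fun z : R => Rpower z (- x)) _ _ H2).
  replace (- (x + 1)) with (- x - 1) by ring.
  rewrite !Rpower_minus_1 by lra; field; lra. }
assert (HF'c : forall t, 0 < t -> continuous F' t).
{ intros t Ht; apply (ex_derive_continuous (V := R_NormedModule)).
  unfold F', Rpower; auto_derive; repeat split; lra. }
assert (HI : is_RInt F' a b (F b - F a)).
{ apply (is_RInt_derive F F').
  - intros t; rewrite Rmin_left, Rmax_right by lra; intros; apply HF; lra.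
  - intros t; rewrite Rmin_left, Rmax_right by lra; intros; apply HF'c; lra. }
apply Rle_trans with (RInt F' a b).
{ apply RInt_le; [lra| | |].
  - apply continuous_ex_RInt_pos; [apply gamma_integrand_continuous|lra..].
  - eexists; exact HI.
  - intros t Ht; unfold gamma_integrand, F'.
    replace (K * (Rpower t (x - 1) * Rpower (1 + t) (- (x + 1))))
      with (Rpower t (x - 1) * (K * Rpower (1 + t) (- (x + 1)))) by ring.
    apply Rmult_le_compat_l; [apply Rlt_le, exp_pos|apply HKt; lra]. }
rewrite (is_RInt_unique _ _ _ _ HI).
assert (HKx : 0 < K / x) by (apply Rdiv_lt_0_compat; lra).
assert (0 <= F a).
{ apply Rmult_le_pos; [lra|]; apply Rmult_le_pos; apply Rlt_le, exp_pos. }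
assert (F b <= K / x); [|lra].
unfold F; rewrite <- (Rmult_1_r (K / x)) at 2.
apply Rmult_le_compat_l; [lra|].
rewrite Rpower_Ropp; apply Rle_div_l; [apply exp_pos|].
rewrite Rmult_1_l; apply Rle_Rpower_l; lra.
Qed.

Lemma Gamma_correct x : 0 < x ->
  is_RInt_gen (gamma_integrand x) (at_right 0) (Rbar_locally p_infty) (Gamma x) /\
  is_lub (fun v => exists a b, 0 < a /\ a < b /\
    v = RInt (gamma_integrand x) a b) (Gamma x).
Proof.
intros Hx; destruct (gamma_integrand_RInt_bounded x Hx) as [M HM].
destruct (is_RInt_gen_sup (gamma_integrand x) M) as [l [Hl Hlub]]; auto.
- apply gamma_integrand_continuous.
- intros; apply Rlt_le, gamma_integrand_pos.
- enough (Gamma x = l) as -> by auto.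
  now apply is_RInt_gen_unique.
Qed.

Lemma RInt_le_Gamma x a b : 0 < x -> 0 < a -> a < b ->
  RInt (gamma_integrand x) a b <= Gamma x.
Proof. intros Hx Ha Hab; apply (Gamma_correct x Hx); exists a, b; auto. Qed.

Lemma Gamma_pos x : 0 < x -> 0 < Gamma x.
Proof.
intros Hx; apply Rlt_le_trans with (RInt (gamma_integrand x) 1 2).
- apply RInt_gt_0; [lra|intros; apply gamma_integrand_pos|].
  intros; apply gamma_integrand_continuous; lra.
- apply RInt_le_Gamma; lra.
Qed.

Lemma filter_prod_pos (P : R -> Prop) : (forall t, 0 < t -> P t) ->
  filter_prod (at_right 0) (Rbar_locally p_infty)
    (fun ab => forall t,
       Rmin (fst ab) (snd ab) <= t <= Rmax (fst ab) (snd ab) -> P t).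
Proof.
intros HP; apply Filter_prod with (fun a => 0 < a) (fun b => 0 < b).
- exists (mkposreal 1 Rlt_0_1); auto.
- exists 0; auto.
- intros a b Ha Hb t Ht; simpl in Ht; apply HP.
  apply Rlt_le_trans with (Rmin a b); [now apply Rmin_glb_lt|apply Ht].
Qed.

Lemma is_RInt_gen_of_antiderivative (F f : R -> R) (la lb : R) :
  (forall t, 0 < t -> is_derive F t (f t)) ->
  (forall t, 0 < t -> continuous f t) ->
  filterlim F (at_right 0) (locally la) ->
  filterlim F (Rbar_locally p_infty) (locally lb) ->
  is_RInt_gen f (at_right 0) (Rbar_locally p_infty) (lb - la).
Proof.
intros HF Hf Ha Hb.
assert (HD : forall t, 0 < t -> Derive F t = f t)
  by (intros; now apply is_derive_unique, HF).
apply (is_RInt_gen_ext (Derive F)).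
- eapply filter_imp; [|apply (filter_prod_pos (fun t => Derive F t = f t)), HD].
  intros ab H t Ht; apply H; lra.
- apply is_RInt_gen_Derive; auto.
  + apply (filter_prod_pos (fun t => ex_derive F t)).
    intros t Ht; eexists; now apply HF.
  + apply (filter_prod_pos (fun t => continuous (Derive F) t)).
    intros t Ht; apply (continuous_ext_loc (Derive F) f t); [|now apply Hf].
    apply (filter_imp (fun z => 0 < z)); [intros z Hz; symmetry; now apply HD|].
    apply (open_gt 0); exact Ht.
Qed.

Lemma Rpower_at_right_0 e : 0 < e ->
  filterlim (fun x => Rpower x e) (at_right 0) (locally 0).
Proof.
intros He; apply filterlim_locally; intros eps.
pose proof (cond_pos eps) as Heps.
exists (mkposreal (Rpower eps (/ e)) (exp_pos _)); intros y Hy Hy0.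
unfold ball in Hy |- *; simpl in Hy |- *.
unfold AbsRing_ball, abs, minus, plus, opp in Hy |- *; simpl in Hy |- *.
apply Rabs_def2 in Hy; pose proof (Rpower_pos y e).
apply Rabs_def1; [|lra].
replace (pos eps) with (Rpower (Rpower eps (/ e)) e)
  by (rewrite Rpower_mult, Rinv_l, Rpower_1; lra).
enough (Rpower y e < Rpower (Rpower eps (/ e)) e) by lra.
apply Rlt_Rpower_l; lra.
Qed.

Lemma Rpower_exp_at_infty x : 0 < x ->
  filterlim (fun t => Rpower t x * exp (- t)) (Rbar_locally p_infty) (locally 0).
Proof.
intros Hx; destruct (exp_neg_le_Rpower (x + 1) ltac:(lra)) as [K [HK HKt]].
apply filterlim_locally; intros eps; pose proof (cond_pos eps) as Heps.
exists (K / eps); intros t Ht.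
assert (Ht0 : 0 < t) by (pose proof (Rdiv_lt_0_compat K eps); lra).
unfold ball; simpl; unfold AbsRing_ball, abs, minus, plus, opp; simpl.
assert (0 < Rpower t x * exp (- t)) by (apply Rmult_lt_0_compat; apply exp_pos).
apply Rabs_def1; [|lra].
enough (Rpower t x * exp (- t) < eps) by lra.
apply Rle_lt_trans with (K / (1 + t)).
- apply Rle_trans with (Rpower t x * (K * Rpower (1 + t) (- (x + 1)))).
  + apply Rmult_le_compat_l; [apply Rlt_le, exp_pos|auto].
  + replace (- (x + 1)) with (- x - 1) by ring.
    rewrite Rpower_minus_1, Rpower_Ropp by lra.
    assert (Rpower t x <= Rpower (1 + t) x) by (apply Rle_Rpower_l; lra).
    pose proof (Rpower_pos (1 + t) x).
    replace (Rpower t x * (K * (/ Rpower (1 + t) x / (1 + t))))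
      with (K / (1 + t) * (Rpower t x / Rpower (1 + t) x)) by (field; lra).
    rewrite <- (Rmult_1_r (K / (1 + t))) at 2.
    apply Rmult_le_compat_l; [apply Rlt_le, Rdiv_lt_0_compat; lra|].
    apply Rle_div_l; lra.
- apply Rlt_div_l; [lra|].
  apply Rlt_div_l in Ht; [|lra].
  rewrite Rmult_plus_distr_l; lra.
Qed.

Lemma Gamma_S x : 0 < x -> Gamma (x + 1) = x * Gamma x.
Proof.
intros Hx.
destruct (Gamma_correct x Hx) as [H0 _].
destruct (Gamma_correct (x + 1) ltac:(lra)) as [H1 _].
pose proof (is_RInt_gen_minus _ _ _ _ (is_RInt_gen_scal _ x _ H0) H1) as H.
assert (Hz : is_RInt_gen (fun t => minus (scal x (gamma_integrand x t))
   (gamma_integrand (x + 1) t)) (at_right 0) (Rbar_locally p_infty) (0 - 0)).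
{ apply (is_RInt_gen_of_antiderivative (fun t => Rpower t x * exp (- t))).
  - intros t Ht; unfold gamma_integrand.
    pose proof (Rpower_derive t x Ht) as HR.
    auto_derive; [repeat split; eexists; eassumption|].
    rewrite (is_derive_unique (fun z : R => Rpower z x) _ _ HR).
    replace (x + 1 - 1) with x by ring.
    unfold minus, plus, opp, scal; simpl; unfold mult; simpl.
    rewrite Rpower_minus_1 by exact Ht; field; lra.
  - intros t Ht; apply (ex_derive_continuous (V := R_NormedModule)).
    unfold gamma_integrand, Rpower, minus, plus, opp, scal; simpl; unfold mult; simpl.
    auto_derive; repeat split; exact Ht.
  - replace (locally 0) with (locally (0 * exp (- 0))) by (f_equal; ring).
    apply (filterlim_comp_2 (G := locally 0) (H := locally (exp (- 0))) _ _ Rmult).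
    + now apply Rpower_at_right_0.
    + apply (filterlim_filter_le_1 (F := locally 0) (fun t => exp (- t)));
        [apply filter_le_within|].
      apply (ex_derive_continuous (V := R_NormedModule) (fun t => exp (- t))).
      auto_derive; auto.
    + apply (filterlim_mult (K := R_AbsRing) 0 (exp (- 0))).
  - now apply Rpower_exp_at_infty. }
pose proof (eq_trans (eq_sym (is_RInt_gen_unique _ _ H)) (is_RInt_gen_unique _ _ Hz))
  as E1.
unfold minus, plus, opp, scal in E1; simpl in E1; unfold mult in E1; simpl in E1.
lra.
Qed.

Lemma Gamma_1 : Gamma 1 = 1.
Proof.
replace 1 with (0 - - exp (- 0)) at 2 by (rewrite Ropp_0, exp_0; ring).
apply (is_RInt_gen_unique (V := R_CompleteNormedModule) (gamma_integrand 1)).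
apply (is_RInt_gen_of_antiderivative (fun t => - exp (- t))).
- intros t Ht; unfold gamma_integrand; auto_derive; auto.
  replace (1 - 1) with 0 by ring; rewrite Rpower_O by exact Ht; ring.
- intros t Ht; apply (ex_derive_continuous (V := R_NormedModule)).
  unfold gamma_integrand, Rpower; auto_derive; exact Ht.
- apply (filterlim_filter_le_1 (F := locally 0) (fun t => - exp (- t)));
    [apply filter_le_within|].
  apply (ex_derive_continuous (V := R_NormedModule) (fun t => - exp (- t))).
  auto_derive; auto.
- replace (locally 0) with (Rbar_locally (Rbar_opp 0))
    by (simpl; rewrite Ropp_0; reflexivity).
  apply (is_lim_opp (fun t => exp (- t)) p_infty 0).
  apply (is_lim_comp (fun z => exp z) (fun t => - t) p_infty 0 m_infty).
  + apply is_lim_exp_m.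
  + apply (is_lim_opp (fun t => t) p_infty p_infty), is_lim_id.
  + exists 0; intros; discriminate.
Qed.

Lemma Rpower_le_weighted_mean z th : 0 < z -> 0 < th < 1 ->
  Rpower z th <= th * z + (1 - th).
Proof.
intros Hz Hth.
assert (Hw : 0 < th * z + (1 - th))
  by (assert (0 < th * z) by (apply Rmult_lt_0_compat; lra); lra).
rewrite <- (exp_ln _ Hw) at 1; unfold Rpower.
enough (th * ln z <= ln (th * z + (1 - th))) as [H|H].
{ left; rewrite exp_ln; auto; rewrite <- (exp_ln _ Hw); now apply exp_increasing. }
{ right; rewrite H; reflexivity. }
set (w := th * z + (1 - th)) in *.
pose proof (ln_le_minus_1 (z / w) ltac:(now apply Rdiv_lt_0_compat)) as H1.
pose proof (ln_le_minus_1 (1 / w) ltac:(apply Rdiv_lt_0_compat; lra)) as H2.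
rewrite ln_div in H1, H2 by lra; rewrite ln_1 in H2.
apply Rmult_le_compat_l with (r := th) in H1; [|lra].
apply Rmult_le_compat_l with (r := 1 - th) in H2; [|lra].
assert (th * (z / w - 1) + (1 - th) * (1 / w - 1) = 0)
  by (unfold w; field; unfold w in Hw; lra).
lra.
Qed.

(** Weighted arithmetic-geometric mean inequality applied to [(t/x)^th] under the
    integral, followed by [Gamma (x+1) = x Gamma x].  This is the only consequence
    of the logarithmic convexity of [Gamma] used below. *)
Lemma Gamma_plus_le x th : 0 < x -> 0 < th < 1 ->
  Gamma (x + th) <= Rpower x th * Gamma x.
Proof.
intros Hx Hth.
apply (Gamma_correct (x + th) ltac:(lra)); intros v [a [b [Ha [Hab ->]]]].
assert (Hex : forall z, ex_RInt (gamma_integrand z) a b)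
  by (intros z; apply continuous_ex_RInt_pos; [apply gamma_integrand_continuous|lra..]).
pose proof (Rpower_pos x th) as HP.
pose proof (is_RInt_plus _ _ _ _ _ _
  (is_RInt_scal _ _ _ (Rpower x th * th / x) _ (RInt_correct _ _ _ (Hex (x + 1))))
  (is_RInt_scal _ _ _ (Rpower x th * (1 - th)) _ (RInt_correct _ _ _ (Hex x)))) as HI.
eapply Rle_trans; [refine (is_RInt_le _ _ a b _ _ (Rlt_le _ _ Hab)
  (RInt_correct _ _ _ (Hex (x + th))) HI _)|].
- intros t Ht.
  unfold plus, scal; simpl; unfold mult; simpl; unfold gamma_integrand.
  pose proof (Rpower_le_weighted_mean (t / x) th
    ltac:(apply Rdiv_lt_0_compat; lra) Hth) as H.
  replace (x + 1 - 1) with (x - 1 + 1) by ring.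
  replace (x + th - 1) with (x - 1 + th) by ring.
  rewrite (Rpower_plus (x - 1) th t), (Rpower_plus (x - 1) 1 t), (Rpower_1 t) by lra.
  replace (Rpower t th) with (Rpower x th * Rpower (t / x) th).
  2:{ rewrite Rpower_mult_distr by (try apply Rdiv_lt_0_compat; lra).
      f_equal; field; lra. }
  replace (Rpower x th * th / x * (Rpower t (x - 1) * t * exp (- t)) +
    Rpower x th * (1 - th) * (Rpower t (x - 1) * exp (- t)))
  with (Rpower t (x - 1) * Rpower x th * exp (- t) * (th * (t / x) + (1 - th)))
    by (field; lra).
  replace (Rpower t (x - 1) * (Rpower x th * Rpower (t / x) th) * exp (- t))
  with (Rpower t (x - 1) * Rpower x th * exp (- t) * Rpower (t / x) th) by ring.
  apply Rmult_le_compat_l; [|exact H].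
  repeat apply Rmult_le_pos; apply Rlt_le, exp_pos.
- pose proof (RInt_le_Gamma x a b Hx Ha Hab) as H0.
  pose proof (RInt_le_Gamma (x + 1) a b ltac:(lra) Ha Hab) as H1.
  rewrite Gamma_S in H1 by exact Hx.
  unfold plus, scal; simpl; unfold mult; simpl.
  apply Rmult_le_compat_l with (r := Rpower x th * th / x) in H1.
  2:{ apply Rmult_le_pos; [apply Rmult_le_pos; lra|].
      apply Rlt_le, Rinv_0_lt_compat; lra. }
  apply Rmult_le_compat_l with (r := Rpower x th * (1 - th)) in H0.
  2:{ apply Rmult_le_pos; lra. }
  replace (Rpower x th * th / x * (x * Gamma x))
    with (Rpower x th * th * Gamma x) in H1 by (field; lra).
  lra.
Qed.

(** * Gauss' summation at 1 when c - a - b = 1 *)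

Lemma Gamma_plus_ge x th : 0 < x -> 0 < th < 1 ->
  x * Gamma x <= Rpower (x + th) (1 - th) * Gamma (x + th).
Proof.
intros Hx Hth; rewrite <- Gamma_S by exact Hx.
replace (x + 1) with (x + th + (1 - th)) by ring.
apply Gamma_plus_le; lra.
Qed.

(** This and the next bound squeeze the quotient of two products of [Gamma]
    values with equal sums of arguments, as both arguments tend to infinity. *)
Lemma Gamma_product_upper x w th : 0 < x -> x <= w -> 0 < th < 1 ->
  Gamma (x + th) * Gamma (w + (1 - th)) <= w / x * (Gamma (x + 1) * Gamma w).
Proof.
intros Hx Hw Hth.
pose proof (Gamma_plus_le x th Hx Hth) as H1.
pose proof (Gamma_plus_le w (1 - th) ltac:(lra) ltac:(lra)) as H2.
pose proof (Gamma_pos x Hx); pose proof (Gamma_pos w ltac:(lra)).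
rewrite Gamma_S by exact Hx.
replace (w / x * (x * Gamma x * Gamma w)) with (w * (Gamma x * Gamma w))
  by (field; lra).
apply Rle_trans with
  (Rpower x th * Gamma x * (Rpower w (1 - th) * Gamma w)).
- apply Rmult_le_compat; auto; apply Rlt_le, Gamma_pos; lra.
- replace (Rpower x th * Gamma x * (Rpower w (1 - th) * Gamma w))
    with (Rpower x th * Rpower w (1 - th) * (Gamma x * Gamma w)) by ring.
  apply Rmult_le_compat_r; [apply Rmult_le_pos; lra|].
  replace w with (Rpower w th * Rpower w (1 - th)) at 2
    by (rewrite <- Rpower_plus; replace (th + (1 - th)) with 1 by ring;
        apply Rpower_1; lra).
  apply Rmult_le_compat_r; [apply Rlt_le, exp_pos|].
  apply Rle_Rpower_l; lra.
Qed.

Lemma Gamma_product_lower x w th : 0 < x -> x <= w -> 0 < th < 1 ->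
  w / (w + 1) * (Gamma (x + 1) * Gamma w) <= Gamma (x + th) * Gamma (w + (1 - th)).
Proof.
intros Hx Hw Hth.
pose proof (Gamma_plus_ge x th Hx Hth) as H1.
pose proof (Gamma_plus_ge w (1 - th) ltac:(lra) ltac:(lra)) as H2.
replace (1 - (1 - th)) with th in H2 by ring.
pose proof (Gamma_pos x Hx); pose proof (Gamma_pos w ltac:(lra)).
pose proof (Gamma_pos (x + th) ltac:(lra)).
pose proof (Gamma_pos (w + (1 - th)) ltac:(lra)).
rewrite Gamma_S by exact Hx.
replace (w / (w + 1) * (x * Gamma x * Gamma w))
  with (x * Gamma x * (w * Gamma w) / (w + 1)) by (field; lra).
apply Rle_div_l; [lra|].
apply Rle_trans with (Rpower (x + th) (1 - th) * Gamma (x + th)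
  * (Rpower (w + (1 - th)) th * Gamma (w + (1 - th)))).
- apply Rmult_le_compat; auto; apply Rmult_le_pos; lra.
- replace (Rpower (x + th) (1 - th) * Gamma (x + th)
     * (Rpower (w + (1 - th)) th * Gamma (w + (1 - th))))
  with (Gamma (x + th) * Gamma (w + (1 - th)) *
    (Rpower (x + th) (1 - th) * Rpower (w + (1 - th)) th)) by ring.
  apply Rmult_le_compat_l; [apply Rmult_le_pos; lra|].
  replace (w + 1) with (Rpower (w + 1) (1 - th) * Rpower (w + 1) th)
    by (rewrite <- Rpower_plus; replace (1 - th + th) with 1 by ring;
        apply Rpower_1; lra).
  apply Rmult_le_compat; try (apply Rlt_le, exp_pos); apply Rle_Rpower_l; lra.
Qed.

Lemma Gamma_poch x n : 0 < x -> Gamma (x + INR n) = poch x n * Gamma x.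
Proof.
intros Hx; induction n as [|n IH]; [simpl; rewrite Rplus_0_r; ring|].
rewrite S_INR, <- Rplus_assoc, Gamma_S, IH by (pose proof (pos_INR n); lra).
simpl; ring.
Qed.

Lemma poch_1 n : poch 1 n = INR (fact n).
Proof.
induction n as [|n IH]; [reflexivity|].
change (fact (S n)) with (S n * fact n)%nat.
rewrite mult_INR, S_INR, <- IH; simpl; ring.
Qed.

(** Since [c - a - b = 1] the partial sums at [1] telescope. *)
Lemma hcoef_partial_sum a b n : regular (a + b + 1) ->
  sum_n (hcoef a b (a + b + 1)) n =
  poch (a + 1) n * poch (b + 1) n / (poch (a + b + 1) n * INR (fact n)).
Proof.
intros Hc; induction n as [|n IH].
- rewrite sum_O, hcoef_0; simpl; field.
- rewrite sum_Sn, IH; change (@plus R_AbelianMonoid) with Rplus; unfold hcoef.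
  rewrite (poch_S_l a), (poch_S_l b); simpl (poch _ (S n)).
  change (fact (S n)) with (S n * fact n)%nat; rewrite mult_INR, S_INR.
  pose proof (poch_neq_0 _ n Hc); pose proof (Hc n).
  pose proof (INR_fact_neq_0 n); pose proof (pos_INR n).
  match goal with |- ?x = ?y => change (x = y :> R) end.
  field; repeat split; auto; lra.
Qed.

(** Gauss' value of [F(th-1, p-th; p; 1)].  By [Gamma_poch] the closed form of the
    partial sums is this value times
    [Gamma (n+th) Gamma (n+p+1-th) / (Gamma (n+1) Gamma (n+p))], which tends
    to [1]. *)
Lemma is_lim_seq_hcoef_partial_sum th p : 0 < th < 1 -> 0 < p ->
  is_lim_seq (sum_n (hcoef (th - 1) (p - th) p))
    (Gamma p / (Gamma th * Gamma (p + (1 - th)))).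
Proof.
intros Hth Hp.
pose proof (Gamma_pos p Hp); pose proof (Gamma_pos th ltac:(lra)).
pose proof (Gamma_pos (p + (1 - th)) ltac:(lra)).
set (L := Gamma p / (Gamma th * Gamma (p + (1 - th)))).
assert (HL : 0 < L) by (apply Rdiv_lt_0_compat; [|apply Rmult_lt_0_compat]; lra).
set (r := fun n => Gamma (INR n + th) * Gamma (INR n + p + (1 - th))
  / (Gamma (INR n + 1) * Gamma (INR n + p))).
apply (is_lim_seq_ext (fun n => r n * L)).
{ intros n.
  assert (E : p = th - 1 + (p - th) + 1) by ring.
  assert (Hreg : regular (th - 1 + (p - th) + 1))
    by (apply regular_pos; lra).
  pose proof (hcoef_partial_sum (th - 1) (p - th) n Hreg) as Hs.
  rewrite <- E in Hs; rewrite Hs.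
  replace (th - 1 + 1) with th by ring.
  replace (p - th + 1) with (p + (1 - th)) by ring.
  unfold r, L.
  replace (INR n + p + (1 - th)) with (p + (1 - th) + INR n) by ring.
  rewrite !(Rplus_comm (INR n)), !Gamma_poch, Gamma_1, poch_1 by lra.
  pose proof (poch_pos p n Hp); pose proof (INR_fact_lt_0 n).
  field; repeat split; lra. }
replace (Finite L) with (Rbar_mult (Finite 1) (Finite L))
  by (simpl; f_equal; ring).
apply (is_lim_seq_mult' _ _ 1 L); [|apply is_lim_seq_const].
apply is_lim_seq_le_le_loc with
  (fun n => (p + INR n) / (p + 1 + INR n)) (fun n => (p + INR n) / (0 + INR n)).
- exists 1%nat; intros n Hn.
  assert (Hn0 : 0 < INR n) by (apply lt_0_INR; lia).
  pose proof (Gamma_pos (INR n + 1) ltac:(lra)).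
  pose proof (Gamma_pos (INR n + p) ltac:(lra)).
  assert (0 < Gamma (INR n + 1) * Gamma (INR n + p))
    by (apply Rmult_lt_0_compat; auto).
  pose proof (Gamma_product_upper (INR n) (INR n + p) th Hn0 ltac:(lra) Hth) as Hu.
  pose proof (Gamma_product_lower (INR n) (INR n + p) th Hn0 ltac:(lra) Hth) as Hl.
  unfold r; split.
  + apply -> Rle_div_r; [|auto].
    replace (p + INR n) with (INR n + p) by ring.
    replace (p + 1 + INR n) with (INR n + p + 1) by ring; exact Hl.
  + apply Rle_div_l; [auto|].
    replace (p + INR n) with (INR n + p) by ring.
    rewrite Rplus_0_l; exact Hu.
- apply is_lim_seq_shift_ratio, regular_pos; lra.
- apply is_lim_seq_incr_1.
  apply (is_lim_seq_ext (fun n => (p + 1 + INR n) / (1 + INR n))).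
  { intros n; rewrite S_INR; pose proof (pos_INR n); field; lra. }
  apply is_lim_seq_shift_ratio, regular_pos; lra.
Qed.

(** Abel's theorem when all terms but the first have the same sign: the sum at
    [u] then lies between [L] and each of its own partial sums, and a partial sum
    is continuous at [1]. *)
Lemma PSeries_at_left_1 (cf : nat -> R) (L : R) :
  (forall n, cf (S n) <= 0) ->
  (forall u, 0 <= u < 1 -> ex_pseries cf u) ->
  is_lim_seq (sum_n cf) L ->
  filterlim (PSeries cf) (at_left 1) (locally L).
Proof.
intros Hneg Hex HL.
assert (Hlim : forall u, 0 <= u < 1 ->
  is_lim_seq (sum_n (fun k => cf k * u ^ k)) (PSeries cf u)).
{ intros u Hu; apply Series_correct, ex_pseries_R; auto. }
assert (Hlow : forall u, 0 <= u < 1 -> L <= PSeries cf u).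
{ intros u Hu.
  apply (is_lim_seq_le (sum_n cf) (sum_n (fun k => cf k * u ^ k)) L (PSeries cf u));
    [|exact HL|now apply Hlim].
  induction n as [|n IH]; [rewrite !sum_O; simpl; lra|].
  rewrite !sum_Sn; apply Rplus_le_compat; [exact IH|].
  assert (u ^ S n <= 1 ^ S n) by (apply pow_incr; lra).
  rewrite pow1 in H; pose proof (Hneg n); nra. }
assert (Hup : forall u N, 0 <= u < 1 ->
  PSeries cf u <= sum_n (fun k => cf k * u ^ k) N).
{ intros u N Hu; apply (is_lim_seq_decr_compare _ _ (Hlim u Hu)).
  intros n; rewrite sum_Sn; change (@plus R_AbelianMonoid) with Rplus.
  assert (0 <= u ^ S n) by (apply pow_le; lra).
  pose proof (Hneg n); nra. }
apply filterlim_locally; intros eps; pose proof (cond_pos eps) as Heps.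
destruct (proj2 (is_lim_seq_spec _ _) HL (pos_div_2 eps)) as [N HN].
specialize (HN N (le_n N)); simpl in HN; apply Rabs_def2 in HN.
assert (Hc : continuous (fun u => sum_n (fun k => cf k * u ^ k) N) 1).
{ clear; induction N as [|N IH].
  - apply continuous_ext with (fun _ => cf 0%nat * 1);
      [intros; rewrite sum_O; reflexivity|apply continuous_const].
  - apply continuous_ext with
      (fun u => plus (sum_n (fun k => cf k * u ^ k) N) (cf (S N) * u ^ S N));
      [intros; rewrite sum_Sn; reflexivity|].
    apply (continuous_plus (V := R_NormedModule)); [exact IH|].
    apply (ex_derive_continuous (V := R_NormedModule)); auto_derive; auto. }
assert (Hlt : sum_n (fun k => cf k * 1 ^ k) N < L + eps).
{ rewrite (sum_n_ext _ cf); [lra|]; intros k; rewrite pow1; apply Rmult_1_r. }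
destruct (Hc _ (open_lt _ _ Hlt)) as [d Hd].
exists (mkposreal (Rmin d 1) (Rmin_glb_lt _ _ _ (cond_pos d) Rlt_0_1)).
intros u Hu Hu1.
assert (Hud : ball 1 d u) by (apply (ball_le 1 (Rmin d 1)); [apply Rmin_l|exact Hu]).
specialize (Hd u Hud).
unfold ball in Hu; simpl in Hu; unfold AbsRing_ball, abs, minus, plus, opp in Hu.
simpl in Hu; apply Rabs_def2 in Hu; pose proof (Rmin_r d 1).
specialize (Hlow u ltac:(lra)); specialize (Hup u N ltac:(lra)).
unfold ball; simpl; unfold AbsRing_ball, abs, minus, plus, opp; simpl.
apply Rabs_def1; lra.
Qed.

Lemma hcoef_S_neg a b c n : -1 < a < 0 -> 0 < b -> 0 < c -> hcoef a b c (S n) <= 0.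
Proof.
intros Ha Hb Hc.
assert (0 <= poch (a + 1) n) by (apply Rlt_le, poch_pos; lra).
assert (0 <= poch b (S n)) by now apply Rlt_le, poch_pos.
unfold hcoef; rewrite poch_S_l.
pose proof (Rinv_0_lt_compat _ (poch_pos c (S n) Hc)).
pose proof (Rinv_0_lt_compat _ (INR_fact_lt_0 (S n))).
unfold Rdiv.
replace (a * poch (a + 1) n * poch b (S n) * / poch c (S n) * / INR (fact (S n)))
  with (a * (poch (a + 1) n * poch b (S n) * / poch c (S n) * / INR (fact (S n))))
  by ring.
enough (0 <= poch (a + 1) n * poch b (S n) * / poch c (S n) * / INR (fact (S n)))
  by nra.
apply Rmult_le_pos; [apply Rmult_le_pos; [apply Rmult_le_pos|]|]; lra.
Qed.

Lemma hyp2F1_at_left_1 th p : 0 < th < 1 -> th < p ->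
  filterlim (hyp2F1 (th - 1) (p - th) p) (at_left 1)
    (locally (Gamma p / (Gamma th * Gamma (p + (1 - th))))).
Proof.
intros Hth Hp; apply PSeries_at_left_1.
- intros n; apply (hcoef_S_neg (th - 1) (p - th) p); lra.
- intros u Hu; apply hcoef_ex_pseries;
    [apply regular_gt_m1; lra|apply regular_pos; lra..|rewrite Rabs_pos_eq; lra].
- apply is_lim_seq_hcoef_partial_sum; lra.
Qed.

Lemma warp_at_left_1 s : 0 < s -> filterlim (warp s) (at_left 1) (at_left 1).
Proof.
intros Hs P [eps HP].
pose proof (Rpower_at_right_0 s Hs) as Hlim.
destruct (proj1 (filterlim_locally _ _) Hlim eps) as [d Hd].
exists (mkposreal (Rmin d 1) (Rmin_glb_lt _ _ _ (cond_pos d) Rlt_0_1)).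
intros u Hu Hu1.
unfold ball in Hu; simpl in Hu; unfold AbsRing_ball, abs, minus, plus, opp in Hu.
simpl in Hu; apply Rabs_def2 in Hu; pose proof (Rmin_r d 1); pose proof (Rmin_l d 1).
pose proof (Rpower_pos (1 - u) s).
specialize (Hd (1 - u)).
apply HP; [|unfold warp; lra].
unfold ball in Hd |- *; simpl in Hd |- *.
unfold AbsRing_ball, abs, minus, plus, opp in Hd |- *; simpl in Hd |- *.
unfold warp; replace (1 - Rpower (1 - u) s + - (1)) with (- (Rpower (1 - u) s + - 0))
  by ring.
rewrite Rabs_Ropp; apply Hd; [apply Rabs_def1; lra|lra].
Qed.

(** The closed form of the partial sums has factors
    [(th+j) (p+1-th+j) = th (p+1-th) + j (p+1) + j^2], which increase with
    [th (p+1-th)].  In the quotient of the partial sums for [th1] and [th0] the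
    factor [j = 0] is [q > 1] and the others are at least [1]. *)
Lemma Gauss_value_lt th0 th1 p : 0 < th0 -> th0 < th1 -> th1 < 1 -> 1 <= p ->
  Gamma p / (Gamma th0 * Gamma (p + (1 - th0))) <
  Gamma p / (Gamma th1 * Gamma (p + (1 - th1))).
Proof.
intros H0 H01 H1 Hp.
assert (Hprod : th0 * (p + (1 - th0)) < th1 * (p + (1 - th1))) by nra.
assert (Hpos : 0 < th0 * (p + (1 - th0))) by (apply Rmult_lt_0_compat; lra).
set (q := th1 * (p + (1 - th1)) / (th0 * (p + (1 - th0)))).
assert (Hq : 1 < q) by (apply Rlt_div_r; lra).
assert (HL0 : 0 < Gamma p / (Gamma th0 * Gamma (p + (1 - th0)))).
{ apply Rdiv_lt_0_compat; [|apply Rmult_lt_0_compat]; apply Gamma_pos; lra. }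
apply Rlt_le_trans with (q * (Gamma p / (Gamma th0 * Gamma (p + (1 - th0)))));
  [rewrite <- (Rmult_1_l (Gamma p / _)) at 1; apply Rmult_lt_compat_r; auto|].
pose proof (is_lim_seq_hcoef_partial_sum th0 p ltac:(lra) ltac:(lra)) as L0.
pose proof (is_lim_seq_hcoef_partial_sum th1 p ltac:(lra) ltac:(lra)) as L1.
apply is_lim_seq_incr_1 in L0; apply is_lim_seq_incr_1 in L1.
refine (is_lim_seq_le _ _ (Finite (q * _)) (Finite _) _
  (is_lim_seq_scal_l _ q (Finite _) L0) L1).
intros n.
assert (Hs : forall th, 0 < th < 1 ->
  sum_n (hcoef (th - 1) (p - th) p) (S n) =
  poch th (S n) * poch (p + (1 - th)) (S n) / (poch p (S n) * INR (fact (S n)))).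
{ intros th Hth.
  pose proof (hcoef_partial_sum (th - 1) (p - th) (S n)) as E.
  replace (th - 1 + (p - th) + 1) with p in E by ring.
  replace (th - 1 + 1) with th in E by ring.
  replace (p - th + 1) with (p + (1 - th)) in E by ring.
  apply E, regular_pos; lra. }
rewrite !Hs by lra; unfold Rdiv; rewrite <- Rmult_assoc.
apply Rmult_le_compat_r.
{ apply Rlt_le, Rinv_0_lt_compat, Rmult_lt_0_compat;
    [apply poch_pos; lra|apply INR_fact_lt_0]. }
clear L0 L1 Hs; induction n as [|n IH].
{ simpl; rewrite !Rplus_0_r, !Rmult_1_l; right; unfold q; field; lra. }
change (poch ?z (S (S n))) with (poch z (S n) * (z + INR (S n))).
set (k := INR (S n)) in *.
assert (Hk : 0 <= k) by apply pos_INR.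
replace (q * (poch th0 (S n) * (th0 + k) * (poch (p + (1 - th0)) (S n) *
    (p + (1 - th0) + k))))
  with (q * (poch th0 (S n) * poch (p + (1 - th0)) (S n)) *
    (th0 * (p + (1 - th0)) + k * (p + 1) + k * k)) by ring.
replace (poch th1 (S n) * (th1 + k) * (poch (p + (1 - th1)) (S n) *
    (p + (1 - th1) + k)))
  with (poch th1 (S n) * poch (p + (1 - th1)) (S n) *
    (th1 * (p + (1 - th1)) + k * (p + 1) + k * k)) by ring.
pose proof (poch_pos th0 (S n) ltac:(lra)).
pose proof (poch_pos (p + (1 - th0)) (S n) ltac:(lra)).
apply Rmult_le_compat; auto; try lra.
- apply Rmult_le_pos; [lra|apply Rmult_le_pos; lra].
- assert (0 <= k * (p + 1)) by (apply Rmult_le_pos; lra).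
  assert (0 <= k * k) by (apply Rmult_le_pos; lra); lra.
Qed.

(** * The theorem *)

Lemma inv_Beta a b : 0 < a -> 0 < b -> 1 < a + b ->
  1 / ((a + b - 1) * Beta a b) = Gamma (a + b - 1) / (Gamma a * Gamma b).
Proof.
intros Ha Hb Hab; unfold Beta.
assert (E : Gamma (a + b) = (a + b - 1) * Gamma (a + b - 1))
  by (rewrite <- Gamma_S by lra; f_equal; ring).
rewrite E.
pose proof (Gamma_pos a Ha); pose proof (Gamma_pos b Hb).
pose proof (Gamma_pos (a + b - 1) ltac:(lra)).
field; lra.
Qed.

Lemma slope_at_left_1 a0 b0 a1 b1 s :
  0 < a0 < 1 -> 1 < b0 -> 0 < a1 < 1 -> 1 < b1 -> a0 + b0 = a1 + b1 -> 0 < s ->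
  filterlim (fun u => excess a0 b0 a1 b1 s u / u) (at_left 1)
    (locally (1 / ((a0 + b0 - 1) * Beta a1 b1) - 1 / ((a0 + b0 - 1) * Beta a0 b0))).
Proof.
intros Ha0 Hb0 Ha1 Hb1 Hab Hs.
assert (HB : forall a b, 0 < a < 1 -> 1 < b -> a + b = a0 + b0 ->
  filterlim (hyp2F1 (a - 1) (b - 1) (a + b - 1)) (at_left 1)
    (locally (1 / ((a0 + b0 - 1) * Beta a b)))).
{ intros a b Ha Hb E; rewrite <- E.
  pose proof (hyp2F1_at_left_1 a (a + b - 1) Ha ltac:(lra)) as H.
  replace (a + b - 1 - a) with (b - 1) in H by ring.
  replace (a + b - 1 + (1 - a)) with b in H by ring.
  rewrite inv_Beta by lra.
  exact H. }
set (l1 := 1 / ((a0 + b0 - 1) * Beta a1 b1)).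
set (l0 := 1 / ((a0 + b0 - 1) * Beta a0 b0)).
assert (Hl1 := HB a1 b1 Ha1 Hb1 (eq_sym Hab)); fold l1 in Hl1.
assert (Hl0 := HB a0 b0 Ha0 Hb0 eq_refl); fold l0 in Hl0.
assert (Hn : filterlim (excess a0 b0 a1 b1 s) (at_left 1) (locally (l1 - l0))).
{ unfold excess; apply (filterlim_comp_2 (G := locally l1) (H := locally (- l0)) _ _ Rplus).
  - apply (filterlim_comp _ _ _ (warp s) _ _ (at_left 1)); [now apply warp_at_left_1|].
    exact Hl1.
  - apply (filterlim_comp _ _ _ _ Ropp _ (locally l0)); [exact Hl0|].
    apply (filterlim_opp (V := R_NormedModule)).
  - apply (filterlim_plus (V := R_NormedModule)). }
replace (l1 - l0) with ((l1 - l0) * / 1) by field.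
apply (filterlim_comp_2 (G := locally (l1 - l0)) (H := locally (/ 1)) _ _ Rmult).
- exact Hn.
- apply (filterlim_filter_le_1 (F := locally 1) Rinv); [apply filter_le_within|].
  apply (ex_derive_continuous (V := R_NormedModule) Rinv); auto_derive; lra.
- apply (filterlim_mult (K := R_AbsRing)).
Qed.

(** With [p = alpha + beta] and [M = p - S], which is at most [p^2 / (beta + p)],
    the function [y (M - y)] is increasing on [(0, beta]] if [M >= 2 beta], so that
    [y = beta] is the worst case; otherwise its maximum is [M^2 / 4]. *)
Lemma quadratic_bound alpha beta S y :
  0 < alpha -> 0 < beta -> 0 < y <= beta ->
  beta * (alpha + beta) <= S * (beta + (alpha + beta)) ->
  (beta <= alpha \/
   (alpha + beta) ^ 4 <= 4 * (alpha * beta) * (alpha + beta + beta) ^ 2) ->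
  y * (alpha + beta - S - y) <= beta * alpha.
Proof.
intros Ha Hb Hy HS Hcond.
assert (HS0 : 0 <= S).
{ apply Rmult_le_reg_r with (beta + (alpha + beta)); [lra|].
  assert (0 < beta * (alpha + beta)) by (apply Rmult_lt_0_compat; lra); lra. }
set (M := alpha + beta - S).
assert (Hab : 0 < beta * alpha) by (apply Rmult_lt_0_compat; lra).
destruct (Rle_or_lt M 0) as [HM|HM]; [nra|].
destruct (Rle_or_lt (2 * beta) M) as [HM2|HM2].
{ assert (0 <= (beta - y) * (M - beta - y)) by (apply Rmult_le_pos; lra).
  assert (beta * (M - beta) <= beta * alpha)
    by (apply Rmult_le_compat_l; unfold M; lra).
  lra. }
assert (Hsq : y * (M - y) <= M * M / 4).
{ pose proof (Rle_0_sqr (y - M / 2)) as H; unfold Rsqr in H; lra. }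
enough (M * M <= 4 * (beta * alpha)) by lra.
destruct Hcond as [Hc|Hc].
- assert (M * M <= (2 * beta) * (2 * beta)) by (apply Rmult_le_compat; lra).
  assert (beta * beta <= beta * alpha) by (apply Rmult_le_compat_l; lra).
  lra.
- assert (H1 : M * (alpha + beta + beta) <= (alpha + beta) ^ 2)
    by (unfold M; lra).
  assert (H0 : 0 <= M * (alpha + beta + beta)) by (apply Rmult_le_pos; lra).
  pose proof (Rmult_le_compat _ _ _ _ H0 H0 H1 H1) as H2.
  apply Rmult_le_reg_r with ((alpha + beta + beta) ^ 2); [apply pow_lt; lra|].
  lra.
Qed.

Theorem theorem1p1 (a b c d : R) :
  let alpha := a * (b + 1) in
  let beta := b * (1 - a) in
  let p := a + b in
  let h := alpha * beta * (p + beta) in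
  let k := beta * (p + 1) + p in
  let q := fun delta => (c / d - 1) * beta + (a - b - 1) * delta - delta ^ 2 in
  let delta1 := ((a - b - 1) + sqrt ((p - 1) ^ 2 + 4 * beta * c / d)) / 2 in
  let F1 := fun delta x =>
    hyp2F1 (a - 1 - delta) (b + delta) p (1 - Rpower x d) in
  let F0 := fun x => hyp2F1 (a - 1) b p (1 - Rpower x c) in
  let G := fun delta x => (F1 delta x - F0 x) / (1 - Rpower x c) in
  let C1 := fun delta => d / (p * c) * q delta in
  let C2 := fun delta =>
    1 / (p * Beta (a - delta) (b + 1 + delta)) - 1 / (p * Beta a (b + 1)) in
  0 < a < 1 -> 1 - a <= b ->
  (alpha >= sqrt 3 * beta \/
   (alpha < sqrt 3 * beta /\ 4 * h * (beta + p) >= p ^ 4)) ->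
  0 < c -> 0 < d -> 0 < c / d <= (beta + p) / k ->
  (q delta1 = 0 /\ (forall delta, q delta = 0 -> delta <= delta1) /\
   delta1 < 0) /\
  (forall delta, a - 1 < delta <= delta1 ->
     strictly_decreasing_on (G delta) 0 1 /\
     maps_onto (G delta) 0 1 (C1 delta) (C2 delta) /\
     C1 delta >= 0 /\
     (forall x, 0 < x < 1 ->
        F0 x + C1 delta * (1 - Rpower x c) < F1 delta x /\
        F1 delta x < F0 x + C2 delta * (1 - Rpower x c))) /\
  (forall delta, delta1 < delta < 0 ->
     ~ (forall x, 0 < x < 1 -> F0 x < F1 delta x) /\
     ~ (forall x, 0 < x < 1 -> F1 delta x < F0 x)).
Proof.
intros alpha beta p h k q delta1 F1 F0 G C1 C2 Ha Hb Hcond Hc Hd [Hcd0 Hcd].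
assert (Hbeta : 0 < beta) by (apply Rmult_lt_0_compat; lra).
assert (Halpha : 0 < alpha) by (apply Rmult_lt_0_compat; lra).
assert (Hp : p = alpha + beta) by (unfold p, alpha, beta; ring).
assert (Hp1 : 1 <= p) by (unfold p; lra).
set (s := d / c).
assert (Hs0 : 0 < s) by (now apply Rdiv_lt_0_compat).
assert (Hcs : c / d = / s) by (unfold s; field; lra).
assert (Hbp : 0 < beta * p) by (apply Rmult_lt_0_compat; lra).
assert (Hk : 0 < k) by (unfold k; lra).
(* the bound on [c/d] in the form [s - 1 >= beta p / (beta + p)] *)
assert (HsS : beta * p <= (s - 1) * (beta + p)).
{ apply (Rmult_le_compat_r (s * k)) in Hcd; [|apply Rmult_le_pos; lra].
  rewrite Hcs in Hcd.
  replace (/ s * (s * k)) with k in Hcd by (field; lra).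
  replace ((beta + p) / k * (s * k)) with (s * (beta + p)) in Hcd by (field; lra).
  unfold k in Hcd; lra. }
assert (Hs : 1 < s).
{ apply Rmult_lt_reg_r with (beta + p); lra. }
assert (Hs2 : beta <= 2 * (s - 1)).
{ apply Rmult_le_reg_r with (beta + p); [lra|].
  assert (beta * beta <= beta * p) by (apply Rmult_le_compat_l; lra); lra. }
set (D := (p - 1) ^ 2 + 4 * beta * c / d) in delta1.
assert (HbcD : 0 < 4 * beta * c / d < 4 * beta).
{ replace (4 * beta * c / d) with (4 * beta * / s) by (rewrite <- Hcs; field; lra).
  assert (0 < / s) by now apply Rinv_0_lt_compat.
  assert (/ s < 1) by (rewrite <- Rinv_1; apply Rinv_lt_contravar; lra).
  split; [apply Rmult_lt_0_compat; lra|].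
  rewrite <- (Rmult_1_r (4 * beta)) at 2; apply Rmult_lt_compat_l; lra. }
assert (HD : 0 <= D) by (pose proof (pow2_ge_0 (p - 1)); unfold D; lra).
assert (HsD : sqrt D * sqrt D = D) by now apply sqrt_sqrt.
assert (HsDlo : p - 1 <= sqrt D).
{ rewrite <- (sqrt_pow2 (p - 1)) by lra; apply sqrt_le_1_alt; unfold D; lra. }
assert (HsDhi : sqrt D < b + 1 - a).
{ rewrite <- (sqrt_pow2 (b + 1 - a)) by lra; apply sqrt_lt_1_alt.
  split; [exact HD|].
  replace ((b + 1 - a) ^ 2) with ((p - 1) ^ 2 + 4 * beta)
    by (unfold p, beta; ring).
  unfold D; lra. }
assert (Hq1 : q delta1 = 0).
{ unfold q, delta1.
  replace (4 * beta * c / d) with (4 * beta * (c / d)) in * by (field; lra).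
  unfold D in *; fold D in HsD |- *.
  assert (E : D = (p - 1) ^ 2 + 4 * beta * (c / d)) by (unfold D; field; lra).
  replace (((a - b - 1 + sqrt D) / 2) ^ 2)
    with (((a - b - 1) ^ 2 + 2 * (a - b - 1) * sqrt D + sqrt D * sqrt D) / 4)
    by field.
  rewrite HsD, E; unfold p, beta; field; lra. }
assert (Hqfact : forall delta,
  q delta = (delta1 - delta) * (delta + delta1 - (a - b - 1))).
{ intros delta; transitivity (q delta - q delta1); [rewrite Hq1; ring|].
  unfold q; ring. }
(* so that [0 < a - delta < 1] for every [delta] in [(delta1, 0)] as well *)
assert (Hd1lo : a - 1 <= delta1) by (unfold delta1, p in *; lra).
assert (Hqneg : forall delta, delta1 < delta -> q delta < 0).
{ intros delta Hdel; rewrite Hqfact.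
  enough (0 < (delta - delta1) * (delta + delta1 - (a - b - 1))) by lra.
  apply Rmult_lt_0_compat; [lra|].
  pose proof (sqrt_pos D); unfold delta1 in *; lra. }
assert (Hd1neg : delta1 < 0) by (unfold delta1; lra).
assert (HG : forall delta x, 0 < x < 1 ->
  F1 delta x - F0 x =
  excess a (b + 1) (a - delta) (b + 1 + delta) s (1 - Rpower x c)).
{ intros delta x Hx; unfold excess, F1, F0, warp.
  replace (a - delta - 1) with (a - 1 - delta) by ring.
  replace (b + 1 + delta - 1) with (b + delta) by ring.
  replace (a - delta + (b + 1 + delta) - 1) with p by (unfold p; ring).
  replace (b + 1 - 1) with b by ring.
  replace (a + (b + 1) - 1) with p by (unfold p; ring).
  replace (1 - (1 - Rpower x c)) with (Rpower x c) by ring.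
  rewrite Rpower_mult; replace (c * s) with d by (unfold s; field; lra).
  reflexivity. }
assert (Hu : forall x, 0 < x < 1 -> 0 < 1 - Rpower x c < 1).
{ intros x Hx; pose proof (Rpower_pos x c); pose proof (Rpower_lt_1 x c Hx Hc); lra. }
assert (Hinv : forall u, 0 < u < 1 ->
  0 < Rpower (1 - u) (/ c) < 1 /\ 1 - Rpower (Rpower (1 - u) (/ c)) c = u).
{ intros u Hu'; split.
  - split; [apply Rpower_pos|apply Rpower_lt_1; [lra|now apply Rinv_0_lt_compat]].
  - rewrite Rpower_mult, Rinv_l, Rpower_1 by lra; ring. }
assert (Hlim0 : forall delta, a - 1 < delta < 0 ->
  filterlim (fun u => excess a (b + 1) (a - delta) (b + 1 + delta) s u / u)
    (at_right 0) (locally (C1 delta))).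
{ intros delta Hdel.
  pose proof (slope_at_right_0 a (b + 1) (a - delta) (b + 1 + delta) s
    Ha ltac:(lra) ltac:(lra) ltac:(lra) ltac:(lra) Hs0) as H.
  replace (C1 delta) with
   (((1 - a) * (b + 1 - 1) - s * ((1 - (a - delta)) * (b + 1 + delta - 1))) /
        (a + (b + 1) - 1)); [exact H|].
  unfold C1, q, s, beta, p; field; lra. }
assert (Hlim1 : forall delta, a - 1 < delta < 0 ->
  filterlim (fun u => excess a (b + 1) (a - delta) (b + 1 + delta) s u / u)
    (at_left 1) (locally (C2 delta))).
{ intros delta Hdel.
  pose proof (slope_at_left_1 a (b + 1) (a - delta) (b + 1 + delta) s
    Ha ltac:(lra) ltac:(lra) ltac:(lra) ltac:(lra) Hs0) as H.
  replace (a + (b + 1) - 1) with p in H by (unfold p; ring); exact H. }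
split; [|split].
- split; [exact Hq1|split; [|exact Hd1neg]].
  intros delta Hq; apply Rnot_lt_le; intros Hlt; apply Hqneg in Hlt; lra.
- intros delta [Hdlo Hdhi].
  set (f := fun u => excess a (b + 1) (a - delta) (b + 1 + delta) s u / u).
  assert (HGf : forall x, 0 < x < 1 -> G delta x = f (1 - Rpower x c)).
  { intros x Hx; unfold G; rewrite HG by exact Hx; reflexivity. }
  assert (Hqpos : 0 <= q delta).
  { rewrite Hqfact; apply Rmult_le_pos; lra. }
  set (beta1 := (1 - (a - delta)) * (b + 1 + delta - 1)).
  assert (Hbeta1 : 0 < beta1) by (apply Rmult_lt_0_compat; lra).
  assert (Hy : s * beta1 <= beta).
  { apply Rmult_le_reg_l with (/ s); [now apply Rinv_0_lt_compat|].
    replace (/ s * (s * beta1)) with beta1 by (field; lra).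
    rewrite <- Hcs; unfold q in Hqpos.
    replace beta1 with (beta + (1 - a + b) * delta + delta ^ 2)
      by (unfold beta1, beta; ring).
    lra. }
  assert (Hprod1 : (a - delta) * (b + 1 + delta) = p - beta1)
    by (unfold p, beta1; ring).
  assert (Hprod0 : a * (b + 1) = p - beta) by (unfold p, beta; ring).
  assert (Hsb : 0 < s * beta1) by (apply Rmult_lt_0_compat; lra).
  assert (Hincr : forall x y, 0 < x -> x < y -> y < 1 -> f x < f y).
  { intros x y Hx Hxy Hy1; unfold f; apply slope_incr; try lra.
    - rewrite Hprod1, Hprod0; replace (a + (b + 1)) with (p + 1) by (unfold p; ring).
      lra.
    - fold beta1; rewrite Hprod1.
      replace (s * (p - beta1) - (s - 1) * (a + (b + 1)))
        with (alpha + beta - (s - 1) - s * beta1)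
        by (rewrite <- Hp; unfold p; ring).
      replace ((1 - a) * (b + 1 - 1) * (a * (b + 1))) with (beta * alpha)
        by (unfold beta, alpha; ring).
      (* the second alternative of the hypothesis reads
         [p^4 <= 4 alpha beta (p + beta)^2] *)
      apply quadratic_bound; try lra.
      + rewrite <- Hp; exact HsS.
      + destruct Hcond as [Hcd1|[_ Hcd2]]; [left|right].
        * assert (1 <= sqrt 3) by (rewrite <- sqrt_1; apply sqrt_le_1_alt; lra).
          assert (1 * beta <= sqrt 3 * beta) by (apply Rmult_le_compat_r; lra).
          lra.
        * rewrite <- Hp; unfold h in Hcd2; lra. }
  assert (Himage := image_of_strictly_increasing f (C1 delta) (C2 delta) Hincr).
  specialize (Himage ltac:(
    intros x Hx; apply (ex_derive_continuous (V := R_NormedModule));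
    apply (ex_derive_div (excess a (b + 1) (a - delta) (b + 1 + delta) s) (fun u => u));
      [eexists; apply excess_derive; lra|apply ex_derive_id|lra])
    (Hlim0 delta ltac:(lra)) (Hlim1 delta ltac:(lra))).
  split; [|split; [|split]].
  + intros x y Hx Hxy Hy1; rewrite !HGf by lra; apply Hincr.
    * pose proof (Hu y ltac:(lra)); lra.
    * assert (Rpower x c < Rpower y c) by (apply Rlt_Rpower_l; lra); lra.
    * pose proof (Hu x ltac:(lra)); lra.
  + intros y; rewrite Himage; split.
    * intros [u [Hu1 <-]]; exists (Rpower (1 - u) (/ c)).
      destruct (Hinv u Hu1) as [Hx Ex]; split; [exact Hx|].
      rewrite HGf, Ex by exact Hx; reflexivity.
    * intros [x [Hx <-]]; exists (1 - Rpower x c); split; [now apply Hu|].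
      now rewrite HGf.
  + apply Rle_ge, Rmult_le_pos; [|exact Hqpos].
    apply Rlt_le, Rdiv_lt_0_compat; [exact Hd|apply Rmult_lt_0_compat; lra].
  + intros x Hx; destruct (Hu x Hx) as [Hu0 Hu1].
    assert (HGx : C1 delta < G delta x < C2 delta).
    { apply Himage; exists (1 - Rpower x c); split; [now apply Hu|].
      symmetry; now apply HGf. }
    assert (E : F1 delta x - F0 x = G delta x * (1 - Rpower x c))
      by (unfold G; field; lra).
    destruct HGx as [HG1 HG2].
    apply (Rmult_lt_compat_r (1 - Rpower x c)) in HG1; [|exact Hu0].
    apply (Rmult_lt_compat_r (1 - Rpower x c)) in HG2; [|exact Hu0].
    lra.
- intros delta [Hdlo Hdhi].
  assert (Hrange : a - 1 < delta < 0) by lra.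
  split; intros Hall.
  + assert (HC1 : C1 delta < 0).
    { unfold C1; enough (0 < d / (p * c) * - q delta) by lra.
      apply Rmult_lt_0_compat; [|specialize (Hqneg delta Hdlo); lra].
      apply Rdiv_lt_0_compat; [exact Hd|apply Rmult_lt_0_compat; lra]. }
    destruct (filter_ex _ (filter_and _ _ (at_right_0_lt 1 Rlt_0_1)
      (Hlim0 delta Hrange _ (open_lt _ _ HC1)))) as [u [Hu1 Hneg]].
    destruct (Hinv u Hu1) as [Hx Ex].
    specialize (Hall _ Hx).
    pose proof (HG delta _ Hx) as E; rewrite Ex in E.
    assert (0 < excess a (b + 1) (a - delta) (b + 1 + delta) s u / u)
      by (rewrite <- E; apply Rdiv_lt_0_compat; lra).
    lra.
  + assert (HC2 : 0 < C2 delta).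
    { pose proof (Gauss_value_lt a (a - delta) p ltac:(lra) ltac:(lra) ltac:(lra) Hp1)
        as H.
      pose proof (inv_Beta a (b + 1) ltac:(lra) ltac:(lra) ltac:(lra)) as E0.
      pose proof (inv_Beta (a - delta) (b + 1 + delta)
        ltac:(lra) ltac:(lra) ltac:(lra)) as E1.
      replace (a + (b + 1) - 1) with p in E0 by (unfold p; ring).
      replace (a - delta + (b + 1 + delta) - 1) with p in E1 by (unfold p; ring).
      replace (p + (1 - a)) with (b + 1) in H by (unfold p; ring).
      replace (p + (1 - (a - delta))) with (b + 1 + delta) in H by (unfold p; ring).
      unfold C2; rewrite E0, E1; lra. }
    destruct (filter_ex _ (filter_and _ _ (at_left_1_gt 0 Rlt_0_1)
      (Hlim1 delta Hrange _ (open_gt _ _ HC2)))) as [u [Hu1 Hpos]].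
    destruct (Hinv u Hu1) as [Hx Ex].
    specialize (Hall _ Hx).
    pose proof (HG delta _ Hx) as E; rewrite Ex in E.
    assert (0 < - excess a (b + 1) (a - delta) (b + 1 + delta) s u / u)
      by (rewrite <- E; apply Rdiv_lt_0_compat; lra).
    lra.
Qed.
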